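(* There exist universal constants $C_0,D_1,D_2,\gamma>0$ such that the following holds. Let $0<q<1$, let $\Theta$ be a positive integer, let $I=[a,b]$, and let $\nu$ be a probability measure on $I$ with density $\nu(x)$. Let $N,m,s$ be positive integers and $K\ge 1$ with $$m\ge C_0 K^2 s\log^3(s)\log(N+1).$$ Let $\{\psi_0,\psi_1,\dots,\psi_N\}$ be polynomials on $I$ that are orthonormal with respect to $\nu$, whose degrees are strictly increasing and do not exceed $N$, and that are uniformly bounded: $\|\psi_k\|_\infty\le K$ for $k=0,\dots,N$. Let $x_1,\dots,x_m$ be drawn independently from $I$, each with probability density $\nu(x)$, and let $A\in\mathbb{R}^{m\times(N+1)}$ have entries $A_{j,k}=\psi_k(x_j)$, $j=1,\dots,m$, $k=0,\dots,N$. Let $f\in \mathrm{Lip}_M^\alpha$ on $[a,b]$ with $0<\alpha\le 1$, i.e. $|f(x)-f(y)|\le M|x-y|^\alpha$ for all $x,y\in[a,b]$, and put $\mathbf{y}=(f(x_1),\dots,f(x_m))^T$. Then, with probability at least $1-(N+1)^{-\gamma\log^3(s)}$, the following holds: if $\mathbf{c}^\#=(c_0^\#,\dots,c_N^\#)^T$ is a solution of $$\min_{\mathbf{z}\in\mathbb{R}^{N+1}}\|\mathbf{z}\|_1\quad\text{subject to}\quad \|A\mathbf{z}-\mathbf{y}\|_2\le\Theta\sqrt{m}\,E_N,$$ and $p^\#(x)=\sum_{k=0}^N c_k^\#\psi_k(x)$, then $$\|f-p^\#\|_\infty\le K D_1\|p_{opt}\|_{A_q}s^{1-\frac1q}+\left(K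 D_2\Theta+1\right)CM\frac{\sqrt{s}}{N^\alpha},\qquad C=12\left(\frac{b-a}{2}\right)^\alpha.$$ Here $p_{opt}$ is the best uniform approximation polynomial of $f$ in $\Pi_N(I)=\mathrm{span}\{\psi_0,\dots,\psi_N\}$ and $E_N$ is the best uniform approximation error of $f$ in $\Pi_N(I)$.
   Context: $\|g\|_\infty=\max_{x\in[a,b]}|g(x)|$ for continuous $g$ on $[a,b]$. $\Pi_N(I)$ is the space of polynomials on $I$ of degree at most $N$. $E_N=E_N(f)=\inf_{p\in\Pi_N(I)}\|f-p\|_\infty$, and $p_{opt}\in\Pi_N(I)$ satisfies $\|f-p_{opt}\|_\infty=E_N$. Orthonormal with respect to $\nu$ means $\int_I\psi_j(x)\psi_k(x)\nu(x)\,dx=\delta_{jk}$. For a vector $\mathbf{z}$, $\|\mathbf{z}\|_p=(\sum_j|z_j|^p)^{1/p}$ for $0<p<\infty$. For $g=\sum_{k=0}^N c_k\psi_k$, $\|g\|_{A_q}:=\|\mathbf{c}\|_q$, $q>0$. ''Universal constants'' means independent of all the other data. *)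

(* Defs.v *)
From HB Require Import structures.
From mathcomp Require Import all_boot all_order all_algebra.
From mathcomp Require Import all_classical all_reals all_analysis.

Set Implicit Arguments.
Unset Strict Implicit.
Unset Printing Implicit Defensive.

Import Order.TTheory GRing.Theory Num.Theory.
Import numFieldNormedType.Exports.

Local Open Scope classical_set_scope.
Local Open Scope ring_scope.

(* Used only for functions continuous on [a, b], where the supremum is
   attained, i.e. is the maximum. *)
Definition sup_norm (R : realType) (a b : R) (g : R -> R) : R :=
  sup [set `|g x| | x in `[a, b]].

(* (\sum_i |z_i|^p)^(1/p), for p > 0 (a quasi-norm if p < 1) *)
Definition lp_norm (R : realType) (n : nat) (p : R) (z : 'cV[R]_n) : R :=
  (\sum_(i < n) `|z i 0| `^ p) `^ p^-1.

Definition poly_le (R : realType) (N : nat) : set {poly R} :=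
  [set p | (size p <= N.+1)%N].

Definition best_error (R : realType) (a b : R) (N : nat) (f : R -> R) : R :=
  inf [set sup_norm a b (fun x => f x - p.[x]) | p in poly_le N].

Definition best_approx (R : realType) (a b : R) (N : nat) (f : R -> R)
    (p : {poly R}) : Prop :=
  poly_le N p /\ sup_norm a b (fun x => f x - p.[x]) = best_error a b N f.

(* alpha-Hoelder condition with constant M on [a, b]; the library's
   lipschitz predicates only cover alpha = 1. *)
Definition lip_class (R : realType) (a b M alpha : R) (f : R -> R) : Prop :=
  forall x y, x \in `[a, b] -> y \in `[a, b] ->
    `|f x - f y| <= M * `|x - y| `^ alpha.

Definition prob_density (R : realType) (a b : R) (nu : R -> R) : Prop :=
  [/\ measurable_fun `[a, b] nu,
      forall x, x \in `[a, b] -> 0 <= nu x &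
      (\int[lebesgue_measure]_(x in `[a, b]) (nu x)%:E = 1)%E].

Definition orthonormal_wrt (R : realType) (a b : R) (nu : R -> R) (n : nat)
    (psi : 'I_n -> {poly R}) : Prop :=
  forall j k,
    (\int[lebesgue_measure]_(x in `[a, b])
        ((psi j).[x] * (psi k).[x] * nu x)%:E = ((j == k)%:R)%:E)%E.

Definition degrees_increasing (R : realType) (n : nat)
    (psi : 'I_n -> {poly R}) : Prop :=
  forall j k : 'I_n, (j < k)%N -> (size (psi j) < size (psi k))%N.

Definition expansion (R : realType) (n : nat) (psi : 'I_n -> {poly R})
    (c : 'cV[R]_n) : {poly R} :=
  \sum_(k < n) c k 0 *: psi k.

(* Coefficient vector of g in the system psi. It is unique for linearly
   independent psi; 0 is returned when g is not in the span of psi. *)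
Definition coefs (R : realType) (n : nat) (psi : 'I_n -> {poly R})
    (g : {poly R}) : 'cV[R]_n :=
  xget 0 [set c | expansion psi c = g].

Definition A_norm (R : realType) (n : nat) (psi : 'I_n -> {poly R}) (q : R)
    (g : {poly R}) : R :=
  lp_norm q (coefs psi g).

Definition sampling_mx (R : realType) (m n : nat) (psi : 'I_n -> {poly R})
    (x : 'I_m -> R) : 'M[R]_(m, n) :=
  \matrix_(j < m, k < n) (psi k).[x j].

Definition sample_vec (R : realType) (m : nat) (f : R -> R) (x : 'I_m -> R) :
    'cV[R]_m :=
  \col_(j < m) f (x j).

(* c solves: minimize |z|_1 subject to |A z - y|_2 <= eta. *)
Definition l1_solution (R : realType) (m n : nat) (A : 'M[R]_(m, n))
    (y : 'cV[R]_m) (eta : R) (c : 'cV[R]_n) : Prop :=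
  lp_norm 2 (A *m c - y) <= eta /\
  forall z : 'cV[R]_n, lp_norm 2 (A *m z - y) <= eta ->
    lp_norm 1 c <= lp_norm 1 z.

(* The law of X is supported on [a, b], with density nu there; in particular
   X lies in [a, b] almost surely. *)
Definition has_density (R : realType) (d : measure_display)
    (T : measurableType d) (P : probability T R) (a b : R) (nu : R -> R)
    (X : {RV P >-> R}) : Prop :=
  forall B : set R, measurable B ->
    (distribution P X B =
     \int[lebesgue_measure]_(x in `[a, b] `&` B) (nu x)%:E)%E.

(* For a finite family, the product rule for all Borel sets (possibly setT)
   contains the product rule for every subfamily. *)
Definition independent_RVs (R : realType) (d : measure_display)
    (T : measurableType d) (P : probability T R) (m : nat)
    (X : 'I_m -> {RV P >-> R}) : Prop :=
  forall B : 'I_m -> set R, (forall j, measurable (B j)) ->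
    (P (\bigcap_j (X j @^-1` B j)) = \prod_(j < m) P (X j @^-1` B j))%E.

(* Q is not required to be measurable: it contains a measurable event of
   probability at least r. *)
Definition with_prob_ge (R : realType) (d : measure_display)
    (T : measurableType d) (P : probability T R) (r : R) (Q : set T) : Prop :=
  exists E : set T, [/\ measurable E, (r%:E <= P E)%E & E `<=` Q].

(* Main.v *)
Require Import Defs.
From HB Require Import structures.
From mathcomp Require Import all_boot all_order all_algebra.
From mathcomp Require Import all_classical all_reals all_analysis.
From mathcomp Require Import measurable_realfun ring lra zify.

Set Implicit Arguments.
Unset Strict Implicit.
Unset Printing Implicit Defensive.

Import Order.TTheory GRing.Theory Num.Theory.
Import numFieldNormedType.Exports.

Local Open Scope classical_set_scope.
Local Open Scope ring_scope.

(* Let h = c# - c be the difference between a minimizer c# and the coefficient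
   vector c of popt. Minimality puts h, up to the best s-term error of c (which
   Stechkin's inequality bounds by |c|_q s^(1 - 1/q)), in a cone
   |h|_1 <= C sqrt s |h|_2; hence only a lower bound for the empirical second
   moment of the elements of that cone is needed, not the full restricted
   isometry property.

   Normalize |h|_1 = 1, so that the corresponding function is a convex
   combination of the 2(N+1) functions +-psi_k and its second moment is at least
   4^-J, where 4^J is of the order of s. Truncate at the levels K/2^i, i <= J.
   At level i the function is approximated by the mean of about 4^i J random
   draws from the dictionary (Maurey). The probability that this mean is off by
   K/2^(i+1) at x is controlled by an exponential factor times the variance
   sum_d p_d psi_d(x)^2, whose average is bounded under the true and under the
   empirical measure alike: this factor is what keeps log K out of the sample
   size. A Chernoff bound and a union bound over the finitely many means then
   compare true and empirical level sets; summing the dyadic levels gives the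
   lower bound.

   The best approximation error is estimated by Jackson's theorem: f is
   approximated by a step function on an equispaced grid, and the unit step by
   the normalized antiderivative of the fourth power of a Dirichlet kernel. *)

(** * Empirical averages of draws from a dictionary *)

(** Convex combinations form an infinite family, so the tail bounds are applied to means of draws
    and carried over to combinations by an argument that uses the true and the empirical measure at
    once. No good sequence of draws is selected: the comparison holds for every sequence, hence may
    be averaged over the draws, and only the average error counts.

    The sizes are balanced as follows, with n = 4^(i+1) and l the logarithm of the dictionary size.
    The level set at height K/2^(i+1) enters the second moment with weight K^2/n, so an additive
    error of order n/(J K^2 4^J) is affordable there: J such errors sum to a fraction of 4^-J, the
    least second moment considered. The union bound over sequences of about n J draws costs n J l in
    the exponent, which asks for m of order K^2 4^J J^2 l. The third factor J pays for the failure
    probability exp(-J^3 l), through the second summand of [level_slack]. All comparisons are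
    one-sided and lose a factor 2; this makes the tail exponents linear in the additive error. *)

Section Exponential.
Variable R : realType.
Implicit Types x y z : R.

Lemma expR_le_quad z : `|z| <= 1 / 2 -> expR z <= 1 + z + 2 * z ^+ 2.
Proof.
rewrite ler_norml => /andP[z1 z2].
have := expR_ge1Dx (- z); rewrite expRN => h.
have z0 : 0 < 1 - z by lra.
have : expR z <= (1 - z)^-1.
  by rewrite -(invrK (expR z)) lef_pV2 ?posrE ?invr_gt0 ?expR_gt0.
move=> /le_trans; apply.
by rewrite -div1r ler_pdivrMr//; nra.
Qed.

Lemma expR_chord x y : 0 <= x <= 1 -> expR (x * y) <= 1 + x * (expR y - 1).
Proof.
move=> x01; have /andP[x0 x1] := x01.
pose t := Itv01 x0 x1.
have := convex_expR t y 0.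
rewrite !convRE/= expR0 /unstable.onem !mulr0 addr0 mulr1 => /le_trans; apply.
lra.
Qed.

(** The function on the right is even, vanishes at 0 and dominates squares, and by [indic_le_cosh]
    also tail indicators. Subtracting 2 is what makes its mean proportional to the variance. It
    equals the square of e^(z/2) - e^(-z/2), which is at least z/2 for z >= 0. *)
Lemma sqr_le_cosh z : z ^+ 2 <= 4 * (expR z + expR (- z) - 2).
Proof.
wlog z0 : z / 0 <= z => [hw|].
  have [/hw//|/ltW z0] := leP 0 z.
  have := hw (- z); rewrite oppr_ge0 opprK sqrrN => /(_ z0) ?; lra.
have h1 := expR_ge1Dx (z / 2).
have h2 : expR (- (z / 2)) <= 1 by rewrite expR_le1 oppr_le0; lra.
have -> : expR z + expR (- z) - 2 = (expR (z / 2) - expR (- (z / 2))) ^+ 2.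
  rewrite sqrrB -!expRM_natl -expRD subrr expR0.
  have -> : (2 * (z / 2) = z) by field.
  have -> : (2 * (- (z / 2)) = - z) by field.
  rewrite mulr2n; ring.
nra.
Qed.

(** For z >= z0 >= 2 one has e^z >= (1 + z/2)^2 >= 4, so subtracting 2 costs at most half of e^z. *)
Lemma indic_le_cosh z z0 : 2 <= z0 ->
  (z0 <= `|z|)%R%:R <= 2 * expR (- z0) * (expR z + expR (- z) - 2).
Proof.
move=> z02; wlog z0_ : z / 0 <= z => [hw|].
  have [/hw//|/ltW zle0] := leP 0 z.
  have := hw (- z); rewrite oppr_ge0 opprK normrN => /(_ zle0) ?; lra.
rewrite ger0_norm//; have cosh0 := sqr_le_cosh z.
case: (leP z0 z) => [zz|_]; last first.
  by rewrite !mulr_ge0 ?expR_ge0//; nra.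
have h1 : expR z0 <= expR z by rewrite ler_expR.
have h4 : 4 <= expR z.
  have h2 := expR_ge1Dx (z / 2).
  have -> : z = 2 * (z / 2) by field.
  rewrite expRM_natl; nra.
rewrite expRN mulrAC ler_pdivlMr ?expR_gt0//.
have := expR_gt0 (- z) => *; rewrite mul1r; lra.
Qed.

End Exponential.

(** * Maurey's method: exponential moments of means of random draws *)

Section Maurey.
Variables (R : realType) (D : finType) (p : D -> R).
Hypotheses (p_ge0 : forall d, 0 <= p d) (p_sum1 : \sum_d p d = 1).

(** The law of [L] independent draws from [p], as a weight on the finite set of sequences:
    expectations over draws are finite sums. *)
Definition draw_weight L (phi : {ffun 'I_L -> D}) : R := \prod_l p (phi l).

Definition draw_mean L (y : D -> R) (phi : {ffun 'I_L -> D}) : R :=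
  (\sum_l y (phi l)) / L%:R.

Lemma draw_weight_ge0 L (phi : {ffun 'I_L -> D}) : 0 <= draw_weight phi.
Proof. exact: prodr_ge0. Qed.

Lemma sum_draw_weight_prod L (F : D -> R) :
  \sum_(phi : {ffun 'I_L -> D}) draw_weight phi * \prod_l F (phi l) =
  (\sum_d p d * F d) ^+ L.
Proof.
rewrite -[in RHS](card_ord L) -prodr_const.
rewrite (bigA_distr_bigA (fun _ d => p d * F d)).
by apply: eq_bigr => phi _; rewrite big_split.
Qed.

Lemma sum_draw_weight L : \sum_(phi : {ffun 'I_L -> D}) draw_weight phi = 1.
Proof.
rewrite -[RHS](expr1n _ L) -p_sum1.
under [in RHS]eq_bigr do rewrite -[p _]mulr1.
rewrite -(sum_draw_weight_prod L (fun=> 1)).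
by apply: eq_bigr => phi _; rewrite big1 ?mulr1.
Qed.

Section Deviation.
Variables (y : D -> R) (K : R).
Hypotheses (K_gt0 : 0 < K) (yK : forall d, `|y d| <= K).
Let h := \sum_d p d * y d.
Let V := \sum_d p d * y d ^+ 2.

Let hK : `|h| <= K.
Proof.
apply: le_trans (ler_norm_sum _ _ _) _.
rewrite -[K]mul1r -p_sum1 mulr_suml ler_sum// => d _.
by rewrite normrM ger0_norm// ler_wpM2l.
Qed.

Let V_ge0 : 0 <= V.
Proof. by apply: sumr_ge0 => d _; rewrite mulr_ge0// sqr_ge0. Qed.

Let VK : V <= K ^+ 2.
Proof.
rewrite -[K ^+ 2]mul1r -p_sum1 mulr_suml ler_sum// => d _.
by rewrite ler_wpM2l// -real_normK ?num_real// lerXn2r ?nnegrE// ltW.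
Qed.

(** A Bernstein-type bound. Since |y - h| <= 2K, the condition on [lam] brings the exponent into the
    range of [expR_le_quad]; the linear term drops out because [h] is the mean. *)
Lemma draw_mgf L (lam : R) : 4 * (`|lam| * K) <= 1 ->
  \sum_(phi : {ffun 'I_L -> D})
     draw_weight phi * expR (lam * \sum_l (y (phi l) - h)) <=
  expR (2 * L%:R * lam ^+ 2 * V).
Proof.
move=> lamK.
under eq_bigr do rewrite mulr_sumr expR_sum.
rewrite (sum_draw_weight_prod L (fun d => expR (lam * (y d - h)))).
have -> : 2 * L%:R * lam ^+ 2 * V = L%:R * (2 * lam ^+ 2 * V) by ring.
rewrite expRM_natl lerXn2r ?nnegrE ?expR_ge0//.
  by apply: sumr_ge0 => d _; rewrite mulr_ge0 ?expR_ge0.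
apply: le_trans (expR_ge1Dx _).
have step d : p d * expR (lam * (y d - h)) <=
    p d + lam * (p d * y d - p d * h) + 2 * lam ^+ 2 * (p d * (y d - h) ^+ 2).
  have := @expR_le_quad R (lam * (y d - h)).
  rewrite normrM => hd.
  have /hd{}hd : `|lam| * `|y d - h| <= 1 / 2.
    have : `|y d - h| <= 2 * K.
      by rewrite (le_trans (ler_normB _ _))// mulr_natl mulr2n lerD.
    move=> yh; have hl : `|lam| * `|y d - h| <= `|lam| * (2 * K) by rewrite ler_wpM2l.
    rewrite (le_trans hl)//; move: lamK; move: (`|lam|) => l lK; lra.
  apply: le_trans (ler_wpM2l (p_ge0 d) hd) _.
  lra.
apply: le_trans (ler_sum _ (fun d _ => step d)) _.
rewrite 2!big_split/= -!mulr_sumr sumrB -mulr_suml p_sum1 mul1r subrr mulr0 addr0.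
have l2 : 0 <= 2 * lam ^+ 2 by rewrite mulr_ge0// sqr_ge0.
rewrite lerD2l ler_wpM2l//.
have -> : \sum_d p d * (y d - h) ^+ 2 = V - h ^+ 2.
  have e d : p d * (y d - h) ^+ 2 =
      p d * y d ^+ 2 + ((- 2 * h) * (p d * y d) + h ^+ 2 * p d) by ring.
  under eq_bigr do rewrite e.
  rewrite 2!big_split/= -!mulr_sumr p_sum1 -/h -/V; ring.
by rewrite lerBlDr lerDl sqr_ge0.
Qed.

(** The factor [V / K ^+ 2] is pulled out of the exponent by convexity: V <= K^2, so the exponential
    lies below its chord from 0 to the value at V = K^2, and the constants 1 + 1 - 2 cancel. *)
Lemma draw_cosh L (lam : R) : 4 * (`|lam| * K) <= 1 ->
  \sum_(phi : {ffun 'I_L -> D}) draw_weight phi *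
     (expR (lam * \sum_l (y (phi l) - h)) +
      expR (- (lam * \sum_l (y (phi l) - h))) - 2) <=
  2 * (V / K ^+ 2) * expR (2 * L%:R * lam ^+ 2 * K ^+ 2).
Proof.
move=> lamK.
under eq_bigr do rewrite mulrBr mulrDr.
rewrite sumrB big_split/= -mulr_suml sum_draw_weight mul1r.
have h1 := draw_mgf L lamK.
have h2 : \sum_(phi : {ffun 'I_L -> D})
     draw_weight phi * expR (- (lam * \sum_l (y (phi l) - h))) <=
     expR (2 * L%:R * lam ^+ 2 * V).
  under eq_bigr do rewrite -mulNr.
  by rewrite -(sqrrN lam); apply: draw_mgf; rewrite normrN.
set b := 2 * L%:R * lam ^+ 2 * K ^+ 2.
have h3 : expR (2 * L%:R * lam ^+ 2 * V) <= 1 + (V / K ^+ 2) * (expR b - 1).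
  have -> : 2 * L%:R * lam ^+ 2 * V = V / K ^+ 2 * b.
    by rewrite /b; field; rewrite gt_eqF.
  apply: expR_chord.
  rewrite divr_ge0 ?sqr_ge0//=.
  by rewrite ler_pdivrMr ?exprn_gt0// mul1r.
have V0 : 0 <= V / K ^+ 2 by rewrite divr_ge0 ?sqr_ge0.
rewrite (le_trans (lerB (lerD h1 h2) (lexx 2)))//.
by rewrite -subr_ge0; move: (expR b) h3 => eb h3; nra.
Qed.

Lemma draw_mean_dev L (phi : {ffun 'I_L -> D}) : (0 < L)%N ->
  \sum_l (y (phi l) - h) = L%:R * (draw_mean y phi - h).
Proof.
move=> L0; rewrite sumrB sumr_const card_ord mulrBr -(mulr_natl h).
by rewrite /draw_mean [L%:R * (_ / _)]mulrC divfK// pnatr_eq0 -lt0n.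
Qed.

(** For L lam^2 K^2 = 1 the factor in front of V is a constant over L, the usual size of a
    variance. *)
Lemma draw_variance L (lam : R) : (0 < L)%N -> 0 < lam -> 4 * (lam * K) <= 1 ->
  \sum_(phi : {ffun 'I_L -> D}) draw_weight phi * (draw_mean y phi - h) ^+ 2 <=
  8 * expR (2 * L%:R * lam ^+ 2 * K ^+ 2) / (lam * L%:R * K) ^+ 2 * V.
Proof.
move=> L0 lam0 lamK.
have L0' : 0 < L%:R :> R by rewrite ltr0n.
have /(draw_cosh L) : 4 * (`|lam| * K) <= 1 by rewrite gtr0_norm.
set E := expR (2 * _ * _ * _) => hc.
have -> : 8 * E / (lam * L%:R * K) ^+ 2 * V =
    (4 * (2 * (V / K ^+ 2) * E)) / (lam * L%:R) ^+ 2.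
  by field; rewrite !gt_eqF.
rewrite ler_pdivlMr ?exprn_gt0 ?mulr_gt0//.
apply: le_trans (ler_wpM2l _ hc); last by [].
rewrite mulr_suml mulr_sumr ler_sum// => phi _.
rewrite -mulrA [leRHS]mulrCA ler_wpM2l ?draw_weight_ge0//.
rewrite -exprMn draw_mean_dev//.
have -> : (draw_mean y phi - h) * (lam * L%:R) =
   lam * (L%:R * (draw_mean y phi - h)) by ring.
exact: sqr_le_cosh.
Qed.

Lemma draw_tail L (lam u : R) : (0 < L)%N -> 0 < lam -> 4 * (lam * K) <= 1 ->
  2 <= lam * L%:R * u ->
  \sum_(phi : {ffun 'I_L -> D})
    draw_weight phi * (u <= `|draw_mean y phi - h|)%R%:R <=
  4 / K ^+ 2 * expR (2 * L%:R * lam ^+ 2 * K ^+ 2 - lam * L%:R * u) * V.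
Proof.
move=> L0 lam0 lamK z02.
have L0' : 0 < L%:R :> R by rewrite ltr0n.
have /(draw_cosh L) : 4 * (`|lam| * K) <= 1 by rewrite gtr0_norm.
rewrite expRD.
set E := expR (2 * _ * _ * _) => hc; set z0 := lam * _ * _ in z02 *.
have -> : 4 / K ^+ 2 * (E * expR (- z0)) * V =
    2 * expR (- z0) * (2 * (V / K ^+ 2) * E) by ring.
apply: le_trans (ler_wpM2l _ hc); last by rewrite mulr_ge0 ?expR_ge0.
rewrite mulr_sumr ler_sum// => phi _.
rewrite [leRHS]mulrCA ler_wpM2l ?draw_weight_ge0//.
rewrite draw_mean_dev// mulrA.
apply: le_trans (indic_le_cosh _ z02).
rewrite normrM (gtr0_norm (mulr_gt0 lam0 L0')) /z0.
by rewrite ler_pM2l// mulr_gt0.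
Qed.

End Deviation.
End Maurey.

(** * Positive functionals on bounded measurable functions *)

Section BoundedMeasurable.
Context d (T : measurableType d) (R : realType).
Implicit Types F G : T -> R.

Definition bounded_measurable F :=
  measurable_fun setT F /\ exists B, forall x, `|F x| <= B.

Lemma bounded_measurable_cst c : bounded_measurable (fun=> c).
Proof. by split=> //; exists `|c|. Qed.

Lemma bounded_measurableD F G : bounded_measurable F -> bounded_measurable G ->
  bounded_measurable (fun x => F x + G x).
Proof.
move=> [mF [B hB]] [mG [C hC]]; split; first exact: measurable_funD.
exists (B + C) => x; rewrite (le_trans (ler_normD _ _))// lerD//.
Qed.

Lemma bounded_measurableM F G : bounded_measurable F -> bounded_measurable G ->
  bounded_measurable (fun x => F x * G x).
Proof.
move=> [mF [B hB]] [mG [C hC]]; split; first exact: measurable_funM.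
by exists (B * C) => x; rewrite normrM ler_pM.
Qed.

Lemma bounded_measurableZ c F : bounded_measurable F ->
  bounded_measurable (fun x => c * F x).
Proof. by move=> ?; apply: bounded_measurableM => //; exact: bounded_measurable_cst. Qed.

Lemma bounded_measurableB F G : bounded_measurable F -> bounded_measurable G ->
  bounded_measurable (fun x => F x - G x).
Proof.
move=> bF bG; under eq_fun do rewrite -mulN1r.
by apply: bounded_measurableD => //; exact: bounded_measurableZ.
Qed.

Lemma bounded_measurableX n F : bounded_measurable F ->
  bounded_measurable (fun x => F x ^+ n).
Proof.
move=> bF; elim: n => [|n ih]; first exact: bounded_measurable_cst.
by under eq_fun do rewrite exprS; exact: bounded_measurableM.
Qed.

Lemma bounded_measurable_sum (I : Type) (s : seq I) (F : I -> T -> R) :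
  (forall i, bounded_measurable (F i)) ->
  bounded_measurable (fun x => \sum_(i <- s) F i x).
Proof.
move=> bF; elim: s => [|i s ih].
  by under eq_fun do rewrite big_nil; exact: bounded_measurable_cst.
by under eq_fun do rewrite big_cons; exact: bounded_measurableD.
Qed.

Lemma bounded_measurable_min c F : bounded_measurable F ->
  bounded_measurable (fun x => Num.min (F x) c).
Proof.
move=> [mF [B hB]]; split; first exact: measurable_minr.
exists (B + `|c|) => x; rewrite /Num.min; case: ifP => _.
  by rewrite (le_trans (hB x))// lerDl.
by rewrite lerDr (le_trans _ (hB x)).
Qed.

Definition exceeds (u v : R) : R := (u <= `|v|)%R%:R.

Lemma bounded_measurable_exceeds u F : bounded_measurable F ->
  bounded_measurable (fun x => exceeds u (F x)).
Proof.
move=> [mF _]; split; last first.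
  by exists 1 => x; rewrite /exceeds; case: (u <= _); rewrite ?normr0 ?normr1.
have -> : (fun x => exceeds u (F x)) = \1_[set x | u <= `|F x|].
  by apply/funext => x; rewrite indicE/= mem_setE.
apply: measurable_indic.
rewrite -[X in measurable X]setTI.
have := @measurable_fun_ler _ _ _ setT (cst u) (fun x => `|F x|).
move=> /(_ (measurable_cst _) (measurableT_comp (@normr_measurable R setT) mF)).
by move=> /(_ measurableT [set true] I).
Qed.

(** Covers both the integral against the sampling law and the average over a fixed sample, so that
    the transfer lemmas treat the two alike. Finite additivity is enough to exchange such a
    functional with the sum over draws. *)
Definition mean_functional (Q : (T -> R) -> R) :=
  [/\ forall F G, bounded_measurable F -> bounded_measurable G ->
        Q (fun x => F x + G x) = Q F + Q G,
      forall c F, bounded_measurable F -> Q (fun x => c * F x) = c * Q F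
    & forall F G, bounded_measurable F -> bounded_measurable G ->
        (forall x, F x <= G x) -> Q F <= Q G].

Lemma mean_functional_sum Q (I : Type) (s : seq I) (c : I -> R) (F : I -> T -> R) :
  mean_functional Q -> (forall i, bounded_measurable (F i)) ->
  Q (fun x => \sum_(i <- s) c i * F i x) = \sum_(i <- s) c i * Q (F i).
Proof.
move=> [QD QZ _] bF; elim: s => [|i s ih].
  rewrite big_nil (_ : (fun _ => _) = (fun=> 0 * 0)).
    by rewrite QZ ?mul0r//; exact: bounded_measurable_cst.
  by apply/funext => x; rewrite big_nil mul0r.
rewrite big_cons; under eq_fun do rewrite big_cons.
rewrite QD ?QZ ?ih//; first exact: bounded_measurableZ.
by apply: bounded_measurable_sum => j; exact: bounded_measurableZ.
Qed.

End BoundedMeasurable.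

(** * From means of draws to convex combinations *)

Section Transfer.
Context d (T : measurableType d) (R : realType) (D : finType).
Variables (psi : D -> T -> R) (K : R) (p : D -> R).
Hypotheses (K_gt0 : 0 < K) (psiK : forall i x, `|psi i x| <= K).
Hypothesis psi_meas : forall i, measurable_fun setT (psi i).
Hypotheses (p_ge0 : forall i, 0 <= p i) (p_sum1 : \sum_i p i = 1).

Let h x := \sum_i p i * psi i x.
Let g L (phi : {ffun 'I_L -> D}) x := draw_mean (psi^~ x) phi.

Let bpsi i : bounded_measurable (psi i).
Proof. by split=> //; exists K. Qed.

Let bh : bounded_measurable h.
Proof. by apply: bounded_measurable_sum => i; exact: bounded_measurableZ. Qed.

Let bg L (phi : {ffun 'I_L -> D}) : bounded_measurable (g phi).
Proof.
rewrite /g /draw_mean; under eq_fun do rewrite mulrC.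
by apply: bounded_measurableZ; exact: bounded_measurable_sum.
Qed.

(** After the exchange of [Q] with the sum over draws, a pointwise bound by the variance proxy costs
    only the second moments [v] of the dictionary, not their uniform bound K^2. *)
Lemma draw_average_mean Q L (G : {ffun 'I_L -> D} -> T -> R) c v :
  mean_functional Q -> (forall phi, bounded_measurable (G phi)) -> 0 <= c ->
  (forall i, Q (fun x => psi i x ^+ 2) <= v) ->
  (forall x, \sum_phi draw_weight p phi * G phi x <=
             c * \sum_i p i * psi i x ^+ 2) ->
  \sum_phi draw_weight p phi * Q (G phi) <= c * v.
Proof.
move=> mQ bG c0 Qv hG; have [QD QZ Qle] := mQ.
rewrite -mean_functional_sum//.
have b2 : bounded_measurable (fun x => \sum_i p i * psi i x ^+ 2).
  apply: bounded_measurable_sum => i; apply: bounded_measurableZ.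
  exact: bounded_measurableX.
apply: le_trans (Qle _ _ _ _ hG) _.
- by apply: bounded_measurable_sum => phi; exact: bounded_measurableZ.
- exact: bounded_measurableZ.
rewrite QZ// ler_wpM2l// mean_functional_sum//; last first.
  by move=> i; exact: bounded_measurableX.
rewrite -[v]mul1r -p_sum1 mulr_suml ler_sum// => i _.
by rewrite ler_wpM2l.
Qed.

Lemma le_of_draw_average L (r : {ffun 'I_L -> D} -> R) a e :
  (forall phi, a <= r phi) -> \sum_phi draw_weight p phi * r phi <= e -> a <= e.
Proof.
move=> ar; apply: le_trans.
rewrite -[a]mul1r -(sum_draw_weight p_sum1 L) mulr_suml ler_sum// => phi _.
by rewrite ler_wpM2l ?draw_weight_ge0.
Qed.

Variables (Q1 Q2 : (T -> R) -> R).
Hypotheses (mQ1 : mean_functional Q1) (mQ2 : mean_functional Q2).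
Hypothesis Q1v : forall i, Q1 (fun x => psi i x ^+ 2) <= 3.
Hypothesis Q2v : forall i, Q2 (fun x => psi i x ^+ 2) <= 3.

(** If |h| >= 2t but the mean is below t, or the mean is at least t but |h| < t/2, then the two
    differ by at least t/2. Averaged over the draws this event has weight at most 3c under [Q1] and,
    counted twice, 6c under [Q2]; hence 36 = 9 * 4. *)
Lemma level_transfer L lam t y : (0 < L)%N -> 0 < t -> 0 < lam ->
  4 * (lam * K) <= 1 -> 2 <= lam * L%:R * (t / 2) ->
  (forall phi : {ffun 'I_L -> D},
     Q1 (fun x => exceeds t (g phi x)) <=
     2 * Q2 (fun x => exceeds t (g phi x)) + y) ->
  Q1 (fun x => exceeds (2 * t) (h x)) <=
  2 * Q2 (fun x => exceeds (t / 2) (h x)) + y +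
  36 / K ^+ 2 * expR (2 * L%:R * lam ^+ 2 * K ^+ 2 - lam * L%:R * (t / 2)).
Proof.
move=> L0 t0 lam0 lamK lamt hyp.
set c := 4 / K ^+ 2 * expR (2 * L%:R * lam ^+ 2 * K ^+ 2 - lam * L%:R * (t / 2)).
have c0 : 0 <= c by rewrite mulr_ge0 ?expR_ge0// divr_ge0 ?sqr_ge0.
pose G (phi : {ffun 'I_L -> D}) x := exceeds (t / 2) (g phi x - h x).
have bG phi : bounded_measurable (G phi).
  by apply: bounded_measurable_exceeds; exact: bounded_measurableB.
have hG x : \sum_phi draw_weight p phi * G phi x <= c * \sum_i p i * psi i x ^+ 2.
  exact: draw_tail.
have s1 := draw_average_mean mQ1 bG c0 Q1v hG.
have s2 := draw_average_mean mQ2 bG c0 Q2v hG.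
rewrite -lerBlDl.
apply: (@le_of_draw_average L (fun phi => Q1 (G phi) + 2 * Q2 (G phi))); last first.
  under eq_bigr do rewrite mulrDr [_ * (2 * _)]mulrCA.
  rewrite big_split/= -mulr_sumr.
  have -> : 36 / K ^+ 2 = 9 * (4 / K ^+ 2) by field; rewrite gt_eqF.
  rewrite -mulrA -/c; lra.
move=> phi; rewrite lerBlDl.
have [Q1D Q1Z Q1le] := mQ1; have [Q2D Q2Z Q2le] := mQ2.
have bx u F (bF : bounded_measurable F) :
  bounded_measurable (fun x => exceeds u (F x)) := bounded_measurable_exceeds u bF.
have e1 : Q1 (fun x => exceeds (2 * t) (h x)) <=
    Q1 (fun x => exceeds t (g phi x)) + Q1 (G phi).
  rewrite -Q1D//; [|exact: bx]; apply: Q1le => [||x].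
  - exact: bx.
  - by apply: bounded_measurableD => //; exact: bx.
  rewrite /G /exceeds.
  case: (leP (2 * t) _) => //= h1; last by rewrite addr_ge0.
  case: (leP t `|g phi x|) => h2; first by rewrite lerDl.
  case: (leP (t / 2) _) => h3; first by rewrite add0r.
  have := ler_normD (h x - g phi x) (g phi x); rewrite subrK distrC; lra.
have e2 : Q2 (fun x => exceeds t (g phi x)) <=
    Q2 (fun x => exceeds (t / 2) (h x)) + Q2 (G phi).
  rewrite -Q2D//; [|exact: bx]; apply: Q2le => [||x].
  - exact: bx.
  - by apply: bounded_measurableD => //; exact: bx.
  rewrite /G /exceeds.
  case: (leP t _) => //= h1; last by rewrite addr_ge0.
  case: (leP (t / 2) `|h x|) => h2; first by rewrite lerDl.
  case: (leP (t / 2) _) => h3; first by rewrite add0r.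
  have := ler_normD (g phi x - h x) (h x); rewrite subrK; lra.
have := hyp phi; lra.
Qed.

(** Below the last level the truncated squares are compared directly, by u^2 <= 2 v^2 + 2 (v - u)^2,
    which also holds after truncation. Applying this on both sides of the hypothesis gives 2 * 2 * 2
    = 8 and the error 2 * 3c + 8 * 3c = 30c. *)
Lemma low_transfer L lam b y : (0 < L)%N -> 0 <= b -> 0 < lam ->
  4 * (lam * K) <= 1 ->
  (forall phi : {ffun 'I_L -> D},
     Q1 (fun x => Num.min (g phi x ^+ 2) (b ^+ 2)) <=
     2 * Q2 (fun x => Num.min (g phi x ^+ 2) (b ^+ 2)) + y) ->
  Q1 (fun x => Num.min (h x ^+ 2) (b ^+ 2)) <=
  8 * Q2 (fun x => h x ^+ 2) + 2 * y +
  240 * (expR (2 * L%:R * lam ^+ 2 * K ^+ 2) / (lam * L%:R * K) ^+ 2).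
Proof.
move=> L0 b0 lam0 lamK hyp.
set c := 8 * expR (2 * L%:R * lam ^+ 2 * K ^+ 2) / (lam * L%:R * K) ^+ 2.
have c0 : 0 <= c by rewrite divr_ge0 ?sqr_ge0// mulr_ge0 ?expR_ge0.
pose G (phi : {ffun 'I_L -> D}) x := (g phi x - h x) ^+ 2.
have bG phi : bounded_measurable (G phi).
  by apply: bounded_measurableX; exact: bounded_measurableB.
have hG x : \sum_phi draw_weight p phi * G phi x <= c * \sum_i p i * psi i x ^+ 2.
  exact: draw_variance.
have s1 := draw_average_mean mQ1 bG c0 Q1v hG.
have s2 := draw_average_mean mQ2 bG c0 Q2v hG.
rewrite -lerBlDl.
apply: (@le_of_draw_average L (fun phi => 2 * Q1 (G phi) + 8 * Q2 (G phi))); last first.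
  under eq_bigr do rewrite mulrDr [_ * (2 * _)]mulrCA [_ * (8 * _)]mulrCA.
  rewrite big_split/= -!mulr_sumr.
  rewrite (_ : 240 * _ = 30 * c); first lra.
  by rewrite /c; ring.
move=> phi; rewrite lerBlDl.
have [Q1D Q1Z Q1le] := mQ1; have [Q2D Q2Z Q2le] := mQ2.
have bm F : bounded_measurable F ->
    bounded_measurable (fun x => Num.min (F x ^+ 2) (b ^+ 2)).
  by move=> bF; apply: bounded_measurable_min; exact: bounded_measurableX.
have pt u v : Num.min (u ^+ 2) (b ^+ 2) <=
    2 * Num.min (v ^+ 2) (b ^+ 2) + 2 * (v - u) ^+ 2.
  have sq : 0 <= (v - u) ^+ 2 by exact: sqr_ge0.
  have := sqr_ge0 b; have := sqr_ge0 (2 * v - u).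
  rewrite !minEle; case: ifP; case: ifP => ? ?; nra.
have e1 : Q1 (fun x => Num.min (h x ^+ 2) (b ^+ 2)) <=
    2 * Q1 (fun x => Num.min (g phi x ^+ 2) (b ^+ 2)) + 2 * Q1 (G phi).
  rewrite -!Q1Z//; last exact: bm.
  rewrite -Q1D; [|by apply: bounded_measurableZ; exact: bm|exact: bounded_measurableZ].
  apply: Q1le => [||x]; last exact: pt.
  - exact: bm.
  - by apply: bounded_measurableD; apply: bounded_measurableZ => //; exact: bm.
have e2 : Q2 (fun x => Num.min (g phi x ^+ 2) (b ^+ 2)) <=
    2 * Q2 (fun x => h x ^+ 2) + 2 * Q2 (G phi).
  have b2 := bounded_measurableX 2 bh.
  rewrite -!Q2Z// -Q2D; [|exact: bounded_measurableZ..].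
  apply: Q2le => [||x].
  - exact: bm.
  - by apply: bounded_measurableD; exact: bounded_measurableZ.
  rewrite /G; have := sqr_ge0 (2 * h x - g phi x).
  by rewrite minEle; case: ifP => ? ?; nra.
have := hyp phi; lra.
Qed.

End Transfer.

(** * The restricted lower bound over dyadic levels *)

Section Levels.
Variable R : realType.
Implicit Types (K v : R) (J : nat).

Lemma expr4E n : 4 ^+ n = (2 ^+ n) ^+ 2 :> R.
Proof.
have -> : 4 = 2 ^+ 2 :> R by rewrite -natrX.
by rewrite -!exprM mulnC.
Qed.

Lemma level_shift K J (i : 'I_J) :
  K / 2 ^+ (lift ord0 i).+1 = K / 2 / 2 ^+ i.+1.
Proof. by rewrite lift0 exprS invfM mulrA. Qed.

Lemma sum_level_sqr K J : \sum_(i < J) (K / 2 ^+ i.+1) ^+ 2 <= K ^+ 2 / 3.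
Proof.
elim: J K => [|J ih] K; first by rewrite big_ord0 divr_ge0 ?sqr_ge0.
rewrite big_ord_recl expr1; under eq_bigr do rewrite level_shift.
have := ih (K / 2); lra.
Qed.

(** The levels below |v| form a geometric series dominated by its largest term. Induction on [J]
    with [K] halved: once the top level is reached, the whole series is at most K^2/3 = 4/3
    (K/2)^2. *)
Lemma sum_level_exceeds K v J : 0 < K ->
  \sum_(i < J) (K / 2 ^+ i.+1) ^+ 2 * exceeds (K / 2 ^+ i.+1) v <= 4 / 3 * v ^+ 2.
Proof.
elim: J K => [|J ih] K K0; first by rewrite big_ord0 mulr_ge0 ?sqr_ge0.
rewrite big_ord_recl expr1 {1}/exceeds.
case: (leP (K / 2) `|v|) => Kv.
  have v2 : (K / 2) ^+ 2 <= v ^+ 2.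
    have K2 : 0 <= K / 2 by rewrite divr_ge0// ltW.
    by rewrite -[leRHS]real_normK ?num_real// lerXn2r ?nnegrE.
  have := sum_level_sqr K J.+1; rewrite big_ord_recl expr1 => h.
  rewrite mulr1 (le_trans (lerD (lexx _) _) (le_trans h _))//; last by lra.
  by apply: ler_sum => i _; rewrite ler_piMr ?sqr_ge0// /exceeds; case: (_ <= `|v|).
rewrite mulr0 add0r; under eq_bigr do rewrite level_shift.
by apply: ih; rewrite divr_gt0.
Qed.

(** At the first level with |v| >= 2 K/2^(i+1) one still has |v| <= 4 K/2^(i+1), whence 16. If there
    is none, |v| lies below the truncation height. *)
Lemma sqr_le_levels K v J : 0 < K -> `|v| <= 2 * K ->
  v ^+ 2 <= Num.min (v ^+ 2) ((2 * (K / 2 ^+ J)) ^+ 2) +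
    16 * \sum_(i < J) (K / 2 ^+ i.+1) ^+ 2 * exceeds (2 * (K / 2 ^+ i.+1)) v.
Proof.
have sq M : `|v| <= 2 * M -> v ^+ 2 <= (2 * M) ^+ 2.
  move=> vM; rewrite -real_normK ?num_real// lerXn2r ?nnegrE//.
  exact: le_trans vM.
elim: J K => [|J ih] K K0 vK.
  by rewrite big_ord0 expr0 divr1 mulr0 addr0 minEle sq.
rewrite big_ord_recl expr1 {1}/exceeds.
case: (leP (2 * (K / 2)) `|v|) => Kv.
  have s0 : 0 <= \sum_(i < J) (K / 2 ^+ (lift ord0 i).+1) ^+ 2 *
      exceeds (2 * (K / 2 ^+ (lift ord0 i).+1)) v.
    by apply: sumr_ge0 => i _; rewrite mulr_ge0 ?sqr_ge0// /exceeds.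
  have m0 : 0 <= Num.min (v ^+ 2) ((2 * (K / 2 ^+ J.+1)) ^+ 2).
    by rewrite le_min !sqr_ge0.
  by have := sq _ vK; rewrite mulr1 mulrDr => ?; lra.
rewrite mulr0 add0r; under eq_bigr do rewrite level_shift.
have -> : K / 2 ^+ J.+1 = K / 2 / 2 ^+ J by rewrite exprS invfM mulrA.
apply: ih; first by rewrite divr_gt0.
exact: ltW.
Qed.

Lemma exp_level_bound J : (0 < J)%N -> expR (- (13 * J%:R)) <= (2 ^+ 11 * 4 ^+ J)^-1 :> R.
Proof.
move=> J0.
have e2 : 2 <= expR 1 :> R by have := expR_ge1Dx (1 : R); lra.
have p11 : 1 <= 2 ^+ 11 :> R by rewrite exprn_ege1// ler1n.
have h1 : 2 ^+ 11 * 4 ^+ J <= (2 ^+ 13) ^+ J :> R.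
  rewrite (_ : 2 ^+ 13 = 2 ^+ 11 * 4); last first.
    by rewrite (_ : 4 = 2 ^+ 2) -?exprD// -natrX.
  rewrite exprMn ler_wpM2r ?exprn_ge0// -[leLHS]expr1.
  by rewrite ler_weXn2l.
have h2 : (2 ^+ 13) ^+ J <= expR (13 * J%:R) :> R.
  rewrite mulrC expRM_natl lerXn2r ?nnegrE ?expR_ge0 ?exprn_ge0//.
  by rewrite -[13]mulr1 expRM_natl lerXn2r ?nnegrE ?expR_ge0.
rewrite expRN lef_pV2 ?posrE ?expR_gt0 ?mulr_gt0 ?exprn_gt0//.
exact: le_trans h1 h2.
Qed.

Lemma inv_two_pow11 : 0 <= (2 ^+ 11 : R)^-1 <= 1 / 2000.
Proof. by apply/andP; split; lra. Qed.

Lemma expR2_le16 : expR 2 <= 16 :> R.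
Proof.
have h : expR (1 / 2) <= 2 :> R.
  by rewrite (le_trans (expR_le_quad _))// ?ger0_norm//; lra.
have -> : 2 = 4 * (1 / 2) :> R by field.
rewrite expRM_natl (_ : 16 = 2 ^+ 4); last by rewrite -natrX.
by rewrite lerXn2r ?nnegrE ?expR_ge0.
Qed.

End Levels.

Section RestrictedLowerBound.
Context d (T : measurableType d) (R : realType) (D : finType).
Variables (psi : D -> T -> R) (K : R) (J : nat).
Hypotheses (K_gt0 : 0 < K) (psiK : forall i x, `|psi i x| <= K).
Hypothesis psi_meas : forall i, measurable_fun setT (psi i).
Hypothesis J_gt0 : (0 < J)%N.

(** 416 = 32 * 13 makes the deviation exponent -13 J at every level, which beats 4^-J with room to
    spare; see [exp_level_bound]. *)
Definition level_draws (J i : nat) := (416 * 4 ^ i.+1 * J)%N.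
(** The variance of such a mean is a small multiple of 4^-J, since [K] cancels against the choice of
    [lam]. *)
Definition low_draws (J : nat) := ((256 * 2 ^ J) ^ 2)%N.
(** Multiplied by the weight of the level, the first summand gives the same amount at each of the J
    levels and pays for the union bound; the second gives a geometric series and pays for the
    failure probability. *)
Definition level_slack (J i : nat) : R :=
  (4 ^+ i.+1 / J%:R + 1) / (256 * K ^+ 2 * 4 ^+ J).
Definition low_slack (J : nat) : R := (256 * 4 ^+ J)^-1.

Definition level_event (Q1 Q2 : (T -> R) -> R) i :=
  forall phi : {ffun 'I_(level_draws J i) -> D},
     Q1 (fun x => exceeds (K / 2 ^+ i.+1) (draw_mean (psi^~ x) phi)) <=
     2 * Q2 (fun x => exceeds (K / 2 ^+ i.+1) (draw_mean (psi^~ x) phi)) +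
     level_slack J i.

Definition low_event (Q1 Q2 : (T -> R) -> R) :=
  forall phi : {ffun 'I_(low_draws J) -> D},
     Q1 (fun x => Num.min (draw_mean (psi^~ x) phi ^+ 2) ((2 * (K / 2 ^+ J)) ^+ 2)) <=
     2 * Q2 (fun x => Num.min (draw_mean (psi^~ x) phi ^+ 2) ((2 * (K / 2 ^+ J)) ^+ 2)) +
     low_slack J.

Variables (Q1 Q2 : (T -> R) -> R).
Hypotheses (mQ1 : mean_functional Q1) (mQ2 : mean_functional Q2).
Hypothesis Q1v : forall i, Q1 (fun x => psi i x ^+ 2) <= 3.
Hypothesis Q2v : forall i, Q2 (fun x => psi i x ^+ 2) <= 3.
Hypothesis levels_ok : forall i : 'I_J, level_event Q1 Q2 i.
Hypothesis low_ok : low_event Q1 Q2.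

Variable p : D -> R.
Hypotheses (p_ge0 : forall i, 0 <= p i) (p_sum1 : \sum_i p i = 1).
Let h x := \sum_i p i * psi i x.

Let hK x : `|h x| <= K.
Proof.
apply: le_trans (ler_norm_sum _ _ _) _.
rewrite -[K]mul1r -p_sum1 mulr_suml ler_sum// => i _.
by rewrite normrM ger0_norm// ler_wpM2l.
Qed.

Let bh : bounded_measurable h.
Proof.
apply: bounded_measurable_sum => i; apply: bounded_measurableZ.
by split=> //; exists K.
Qed.

Let J_gt0' : 0 < J%:R :> R. Proof. by rewrite ltr0n. Qed.

Let level_bound i : (i < J)%N ->
  16 * ((K / 2 ^+ i.+1) ^+ 2 * Q1 (fun x => exceeds (2 * (K / 2 ^+ i.+1)) (h x))) <=
  128 * ((K / 2 / 2 ^+ i.+1) ^+ 2 * Q2 (fun x => exceeds (K / 2 / 2 ^+ i.+1) (h x))) +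
  (16 * 4 ^+ J)^-1 * J%:R^-1 +
  ((16 * 4 ^+ J)^-1 + 576 * (2 ^+ 11 * 4 ^+ J)^-1) * (1 / 2 ^+ i.+1) ^+ 2.
Proof.
move=> iJ.
pose n : R := 2 ^+ i.+1.
have n0 : 0 < n by rewrite exprn_gt0.
have n2 : 2 <= n by rewrite /n exprS ler_peMr// exprn_ege1// ler1n.
have n4 : 4 ^+ i.+1 = n ^+ 2 by exact: expr4E.
set t := K / 2 ^+ i.+1.
have t0 : 0 < t by rewrite divr_gt0.
have LE : (level_draws J i)%:R = 416 * n ^+ 2 * J%:R :> R.
  by rewrite /level_draws !natrM natrX n4.
have ne : [/\ n != 0, K != 0 & J%:R != 0 :> R] by rewrite !gt_eqF.
case: ne => nn0 nK nJ.
(* With this choice the linear term of the exponent is 26 J and the quadratic one 13 J. *)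
pose lam := (8 * K * n)^-1.
have lam0 : 0 < lam by rewrite invr_gt0 !mulr_gt0.
have L0 : (0 < level_draws J i)%N by rewrite /level_draws !muln_gt0 expn_gt0.
have lamK : 4 * (lam * K) <= 1.
  rewrite (_ : 4 * (lam * K) = 1 / (2 * n)); last by rewrite /lam; field; rewrite ?nn0 ?nK.
  by rewrite ler_pdivrMr ?mulr_gt0// mul1r; lra.
have eE : lam * (level_draws J i)%:R * (t / 2) = 26 * J%:R.
  by rewrite LE /lam /t -/n; field; rewrite ?nn0 ?nK.
have J1 : 1 <= J%:R :> R by rewrite ler1n.
have h2 : 2 <= lam * (level_draws J i)%:R * (t / 2) by rewrite eE; lra.
have := level_transfer K_gt0 psiK psi_meas p_ge0 p_sum1 mQ1 mQ2 Q1v Q2v L0 t0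
  lam0 lamK h2 (@levels_ok (Ordinal iJ)).
rewrite eE -/h LE (_ : 2 * _ * _ * _ - _ = - (13 * J%:R)); last first.
  by rewrite /lam; field; rewrite ?nn0 ?nK.
have := exp_level_bound R J_gt0.
move: (expR _) => e eJ hq.
have -> : K / 2 / 2 ^+ i.+1 = t / 2 by rewrite /t mulrAC.
move: hq; set q1 := Q1 _; set q2 := Q2 _ => hq.
have st : 0 <= 16 * t ^+ 2 by rewrite mulr_ge0// sqr_ge0.
rewrite mulrA (le_trans (ler_wpM2l st hq))//.
have P4 : 4 ^+ J != 0 :> R by rewrite gt_eqF// exprn_gt0.
have -> : 16 * t ^+ 2 * (2 * q2 + level_slack J i + 36 / K ^+ 2 * e) =
    128 * ((t / 2) ^+ 2 * q2) + (16 * 4 ^+ J)^-1 * J%:R^-1 +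
    ((16 * 4 ^+ J)^-1 + 576 * e) * (1 / n) ^+ 2.
  by rewrite /level_slack n4 /t -/n; field; rewrite ?nn0 ?nK ?nJ ?P4.
rewrite lerD2l; apply: ler_wpM2r; first exact: sqr_ge0.
by rewrite lerD2l; exact: (ler_wpM2l (ler0n _ 576)).
Qed.

Let low_bound :
  Q1 (fun x => Num.min (h x ^+ 2) ((2 * (K / 2 ^+ J)) ^+ 2)) <=
  8 * Q2 (fun x => h x ^+ 2) + (128 * 4 ^+ J)^-1 + (15 / 256) / 4 ^+ J.
Proof.
pose n : R := 2 ^+ J.
have n0 : 0 < n by rewrite exprn_gt0.
have n1 : 1 <= n by rewrite exprn_ege1// ler1n.
have n4 : 4 ^+ J = n ^+ 2 by exact: expr4E.
have LE : (low_draws J)%:R = (256 * n) ^+ 2 :> R.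
  by rewrite /low_draws natrX natrM natrX.
have [nn0 nK] : n != 0 /\ K != 0 by rewrite !gt_eqF.
(* Here 2 L lam^2 K^2 = 2 and (lam L K)^2 = L, so the error is 240 e^2 / L, at most 15/256 times
   4^-J. *)
pose lam := (256 * K * n)^-1.
have cn0 : 0 < 256 * n by rewrite mulr_gt0 ?ltr0n.
have lam0 : 0 < lam by rewrite /lam mulrAC invr_gt0 mulr_gt0.
have L0 : (0 < low_draws J)%N by rewrite /low_draws expn_gt0 muln_gt0 expn_gt0.
have lamK : 4 * (lam * K) <= 1.
  rewrite (_ : 4 * (lam * K) = 1 / (64 * n)); last by rewrite /lam; field; rewrite ?nn0 ?nK.
  by rewrite ler_pdivrMr ?mulr_gt0// mul1r; lra.
have b0 : 0 <= 2 * (K / 2 ^+ J) by rewrite mulr_ge0// divr_ge0// ltW.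
have := low_transfer K_gt0 psiK psi_meas p_ge0 p_sum1 mQ1 mQ2 Q1v Q2v L0 b0
  lam0 lamK low_ok.
rewrite -/h LE (_ : 2 * _ * _ * _ = 2); last first.
  by rewrite /lam; field; rewrite ?nn0 ?nK.
move=> /le_trans; apply; rewrite -!addrA lerD2l; apply: lerD.
  rewrite /low_slack n4 le_eqVlt; apply/orP; left; apply/eqP.
  by field.
rewrite n4 (_ : (lam * (256 * n) ^+ 2 * K) ^+ 2 = (256 * n) ^+ 2); last first.
  by rewrite /lam; field; rewrite ?nn0 ?nK.
have e16 := expR2_le16 R.
rewrite mulrA ler_pdivrMr ?(exprn_gt0 2 cn0)//.
rewrite (_ : 15 / 256 / n ^+ 2 * (256 * n) ^+ 2 = 15 * 256); last by field.
by move: (expR 2) e16 => e; lra.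
Qed.

(** The additive errors of all levels together stay below a quarter of 4^-J and are absorbed by the
    left-hand side; the terms with [Q2] add up to 8 + 128 * 4/3, less than three quarters of 400. *)
Lemma restricted_lower_bound : (4 ^+ J)^-1 <= Q1 (fun x => h x ^+ 2) ->
  Q1 (fun x => h x ^+ 2) <= 400 * Q2 (fun x => h x ^+ 2).
Proof.
move=> hJ; have [Q1D Q1Z Q1le] := mQ1; have [Q2D Q2Z Q2le] := mQ2.
have b2 := bounded_measurableX 2 bh.
have bx u : bounded_measurable (fun x => exceeds u (h x)).
  exact: bounded_measurable_exceeds.
have bl (u : nat -> R) (c : nat -> R) : bounded_measurable
    (fun x => \sum_(i < J) c i * exceeds (u i) (h x)).
  by apply: bounded_measurable_sum => i; exact: bounded_measurableZ.
have bm : bounded_measurable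
    (fun x => Num.min (h x ^+ 2) ((2 * (K / 2 ^+ J)) ^+ 2)).
  exact: bounded_measurable_min.
have s1 : Q1 (fun x => h x ^+ 2) <=
    Q1 (fun x => Num.min (h x ^+ 2) ((2 * (K / 2 ^+ J)) ^+ 2)) +
    \sum_(i < J) 16 * ((K / 2 ^+ i.+1) ^+ 2 *
       Q1 (fun x => exceeds (2 * (K / 2 ^+ i.+1)) (h x))).
  have bs := bl (fun i => 2 * (K / 2 ^+ i.+1)) (fun i => (K / 2 ^+ i.+1) ^+ 2).
  rewrite -mulr_sumr -mean_functional_sum// -Q1Z// -Q1D//; last first.
    exact: bounded_measurableZ.
  apply: Q1le => // [|x].
    by apply: bounded_measurableD => //; exact: bounded_measurableZ.
  by apply: sqr_le_levels => //; rewrite (le_trans (hK x))// mulr_natl mulr2n lerDl ltW.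
have s2 : \sum_(i < J) (K / 2 / 2 ^+ i.+1) ^+ 2 *
    Q2 (fun x => exceeds (K / 2 / 2 ^+ i.+1) (h x)) <=
    4 / 3 * Q2 (fun x => h x ^+ 2).
  rewrite -mean_functional_sum// -Q2Z//; apply: Q2le => [||x].
  - exact: (bl (fun i => K / 2 / 2 ^+ i.+1) (fun i => (K / 2 / 2 ^+ i.+1) ^+ 2)).
  - exact: bounded_measurableZ.
  - by apply: sum_level_exceeds; rewrite divr_gt0.
have s3 := @ler_sum R _ (index_enum 'I_J) xpredT _ _
  (fun i _ => level_bound (ltn_ord i)).
have := le_trans s1 (lerD low_bound s3).
rewrite !big_split/= -!mulr_sumr sumr_const card_ord.
have -> : J%:R^-1 *+ J = 1 :> R by rewrite -[LHS]mulr_natr mulVf// gt_eqF.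
have g := sum_level_sqr (1 : R) J.
have P40 : 0 < (4 ^+ J)^-1 :> R by rewrite invr_gt0 exprn_gt0.
have e11 := inv_two_pow11 R.
rewrite (invfM 128) (invfM 16) (invfM (2 ^+ 11)).
move: e11 P40 hJ s2 g; move: (2 ^+ 11)^-1 (4 ^+ J)^-1 => e11 P4.
move: (Q1 _) (Q2 _) (\sum_(i < J) _) (\sum_(i < J) _) => a b S1 S2.
rewrite expr1n mulr1 => /andP[e0 e11b] P40 aP S2b S1g hh.
have e12 : e11 * P4 <= 1 / 2000 * P4 by rewrite ler_wpM2r// ltW.
have e13 : 0 <= e11 * P4 by rewrite mulr_ge0// ltW.
have : (16^-1 * P4 + 576 * (e11 * P4)) * S1 <=
       (16^-1 * P4 + 576 * (e11 * P4)) * (1 / 3).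
  by apply: (ler_wpM2l _ S1g); lra.
lra.
Qed.

End RestrictedLowerBound.

(** * Tail bounds for independent samples *)

Section RealIntegral.
Context d (T : measurableType d) (R : realType) (mu : probability T R).

Lemma bounded_measurable_integrable (F : T -> R) : bounded_measurable F ->
  mu.-integrable setT (EFin \o F).
Proof.
move=> [mF [B hB]]; apply: measurable_bounded_integrable => //.
  by rewrite ltey_eq fin_num_measure.
exists B; split; first exact: num_real.
by move=> M BM x _; apply: le_trans (hB x) _; exact: ltW.
Qed.

Lemma mean_functional_Rintegral : mean_functional (fun F => \int[mu]_x F x).
Proof.
split=> [F G bF bG|c F bF|F G bF bG FG].
- by rewrite RintegralD//; exact: bounded_measurable_integrable.
- by rewrite RintegralZl//; exact: bounded_measurable_integrable.
- by apply: le_Rintegral => //; exact: bounded_measurable_integrable.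
Qed.

Lemma Rintegral_indic (A : set T) : measurable A ->
  \int[mu]_x \1_A x = fine (mu A).
Proof. by move=> mA; rewrite /Rintegral integral_indic// setIT. Qed.

Lemma Rintegral1 : (\int[mu]_x 1)%R = 1 :> R.
Proof.
rewrite Rintegral_cst// mul1r -[RHS]/(fine 1%E); congr fine.
exact: probability_setT.
Qed.

Lemma bounded_measurable_indic (A : set T) : measurable A ->
  bounded_measurable (\1_A : T -> R).
Proof.
move=> mA; split; first exact: measurable_indic.
by exists 1 => x; rewrite indicE; case: (_ \in _); rewrite ?normr0 ?normr1.
Qed.

End RealIntegral.

Lemma bounded_measurable_comp d d' (T : measurableType d) (T' : measurableType d')
    (R : realType) (F : T' -> R) (X : T -> T') :
  measurable_fun setT X -> bounded_measurable F -> bounded_measurable (F \o X).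
Proof.
move=> mX [mF [B hB]]; split; first exact: measurableT_comp.
by exists B => x; exact: hB.
Qed.

Lemma bounded_measurable_prod d (T : measurableType d) (R : realType)
    (I : Type) (s : seq I) (F : I -> T -> R) :
  (forall i, bounded_measurable (F i)) ->
  bounded_measurable (fun x => \prod_(i <- s) F i x).
Proof.
move=> bF; elim: s => [|i s ih].
  by under eq_fun do rewrite big_nil; exact: bounded_measurable_cst.
by under eq_fun do rewrite big_cons; exact: bounded_measurableM.
Qed.

Lemma bounded_measurable_expR d (T : measurableType d) (R : realType)
    (F : T -> R) : bounded_measurable F -> bounded_measurable (expR \o F).
Proof.
move=> [mF [B hB]]; split; first exact: measurableT_comp.
exists (expR B) => x /=; rewrite ger0_norm ?expR_ge0// ler_expR.
exact: le_trans (ler_norm _) (hB x).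
Qed.

(** Values are rounded up to the next multiple of [e]; being uniform, this approximation passes
    through any positive functional without a convergence theorem. *)
Lemma simple_upper_approx d (T : measurableType d) (R : realType) (f : T -> R) e :
  0 < e -> bounded_measurable f -> (forall x, 0 <= f x) ->
  exists k (v : 'I_k -> R) (C : 'I_k -> set T),
  [/\ forall i, measurable (C i),
      forall x, f x <= \sum_i v i * \1_(C i) x &
      forall x, \sum_i v i * \1_(C i) x <= f x + e].
Proof.
move=> e0 [mf [B hB]] f0.
pose k := (Num.truncn (B / e)).+1.
pose C (i : 'I_k) : set T := f @^-1` `[i%:R * e, i.+1%:R * e[%classic.
pose v (i : 'I_k) : R := i.+1%:R * e.
exists k, v, C.
have GE x : exists2 i : 'I_k, C i x & \sum_i v i * \1_(C i) x = v i.
  have fe0 : 0 <= f x / e by rewrite divr_ge0// ltW.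
  have /andP[t1 t2] := truncn_itv fe0.
  have ik : (Num.truncn (f x / e) < k)%N.
    rewrite ltnS le_truncn// ler_pM2r ?invr_gt0//.
    exact: le_trans (ler_norm _) (hB x).
  pose i := Ordinal ik.
  have Cix : C i x by rewrite /C/= in_itv/= -ler_pdivlMr// t1 -ltr_pdivrMr.
  exists i => //; rewrite (bigD1 i)//= indicE mem_set// mulr1.
  rewrite big1 ?addr0// => j ji; rewrite indicE memNset ?mulr0//.
  rewrite /C/= in_itv/= -ler_pdivlMr// -ltr_pdivrMr// => /andP[j1 j2].
  move/eqP: ji; apply; apply/val_inj => /=; apply/esym.
  by apply: truncn_def; rewrite j1 j2.
split=> [i|x|x].
- by have := mf measurableT _ (measurable_itv `[i%:R * e, i.+1%:R * e[); rewrite setTI.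
- by have [i + ->] := GE x; rewrite /C/= in_itv/= => /andP[_ /ltW].
- have [i + ->] := GE x; rewrite /C/= in_itv/= => /andP[h _].
  by rewrite /v -natr1 mulrDl mul1r lerD2r.
Qed.

Lemma mean_functional_eq d (T : measurableType d) (R : realType)
    (Q1 Q2 : (T -> R) -> R) :
  mean_functional Q1 -> mean_functional Q2 ->
  (forall A, measurable A -> Q1 \1_A = Q2 \1_A) ->
  forall F, bounded_measurable F -> (forall x, 0 <= F x) -> Q1 F = Q2 F.
Proof.
suff le : forall Q Q' : (T -> R) -> R, mean_functional Q -> mean_functional Q' ->
    (forall A, measurable A -> Q \1_A = Q' \1_A) ->
    forall F, bounded_measurable F -> (forall x, 0 <= F x) -> Q F <= Q' F.
  move=> mQ1 mQ2 QA F bF F0; apply/eqP; rewrite eq_le.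
  by apply/andP; split; apply: le => // A mA; rewrite QA.
move=> {}Q1 {}Q2 mQ mQ2 QA F bF F0.
have [QD QZ Qle] := mQ; have [QD' QZ' Qle'] := mQ2.
have b1 : bounded_measurable (fun _ : T => 1 : R) by exact: bounded_measurable_cst.
have Q20 : 0 <= Q2 (fun=> 1).
  rewrite -(mul0r (Q2 (fun=> 1))) -QZ'//; apply: Qle' => //.
    exact: bounded_measurable_cst.
apply/ler_addgt0Pr => e e0.
(* The summand 1 keeps the denominator positive even if [Q2] vanishes on constants. *)
pose e' := e / (1 + Q2 (fun=> 1)).
have d0 : 0 < 1 + Q2 (fun=> 1) by lra.
have e'0 : 0 < e' by rewrite divr_gt0.
have [k [v [C [mC FG GF]]]] := simple_upper_approx e'0 bF F0.
have bC i : bounded_measurable (\1_(C i) : T -> R) by exact: bounded_measurable_indic.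
have bG : bounded_measurable (fun x => \sum_i v i * \1_(C i) x).
  by apply: bounded_measurable_sum => i; exact: bounded_measurableZ.
apply: (@le_trans _ _ (Q1 (fun x => \sum_i v i * \1_(C i) x))); first exact: Qle.
rewrite mean_functional_sum//; under eq_bigr do rewrite QA//.
rewrite -(mean_functional_sum _ _ mQ2)//.
apply: (@le_trans _ _ (Q2 (fun x => F x + e' * 1))).
  apply: Qle' => // [|x]; last by rewrite mulr1.
  by apply: bounded_measurableD => //; exact: bounded_measurable_cst.
rewrite QD' ?QZ'//; last exact: bounded_measurable_cst.
rewrite lerD2l /e' mulrAC ler_pdivrMr// ler_pM2l//; lra.
Qed.

Section IID.
Context (R : realType) d (T : measurableType d) (P : probability T R) (m : nat).
Variables (X : 'I_m -> {RV P >-> R}) (mu : probability R R).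
Hypothesis indep : independent_RVs X.
Hypothesis law : forall j (B : set R),
  measurable B -> P (X j @^-1` B) = mu B.

Let QP := mean_functional_Rintegral P.
Let Qmu := mean_functional_Rintegral mu.

Let bX j (F : R -> R) : bounded_measurable F ->
  bounded_measurable (fun w => F (X j w)).
Proof.
move=> bF.
exact: (@bounded_measurable_comp _ _ _ _ _ F (X j) (measurable_funPT (X j)) bF).
Qed.

(** Expanding the product over j into a sum over all choices of cells turns each term into the
    indicator of a box, to which independence applies. *)
Lemma iid_simple_product k (v : 'I_k -> R) (C : 'I_k -> set R) :
  (forall i, measurable (C i)) ->
  \int[P]_w \prod_j (\sum_i v i * \1_(C i) (X j w)) =
  (\int[mu]_x (\sum_i v i * \1_(C i) x)) ^+ m.
Proof.
move=> mC.
pose B (phi : {ffun 'I_m -> 'I_k}) := \bigcap_j (X j @^-1` C (phi j)).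
have mB phi : measurable (B phi).
  apply: fin_bigcap_measurable => // j _.
  by have := measurable_funPT (X j) measurableT _ (mC (phi j)); rewrite setTI.
have BE phi w : \1_(B phi) w = \prod_j \1_(C (phi j)) (X j w) :> R.
  rewrite indicE; have [|wB] := boolP (w \in B phi).
    rewrite inE => wB; rewrite big1// => j _; rewrite indicE mem_set//.
    exact: wB.
  apply/esym/eqP; rewrite prodf_seq_eq0; apply/hasP.
  apply: contrapT => h; move/negP: wB; apply; rewrite inE => j _ /=.
  apply: contrapT => nC; apply: h; exists j; rewrite ?mem_index_enum//=.
  by rewrite indicE memNset.
have PB phi : fine (P (B phi)) = \prod_j fine (mu (C (phi j))).
  rewrite /B indep; last by move=> j; exact: mC.
  rewrite (eq_bigr (fun j => (fine (mu (C (phi j))))%:E)).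
    by rewrite -(big_morph EFin (@EFinM R) erefl).
  by move=> j _; rewrite fineK ?fin_num_measure//; exact: law.
transitivity (\int[P]_w
    (\sum_(phi : {ffun 'I_m -> 'I_k}) (\prod_j v (phi j)) * \1_(B phi) w)).
  apply: eq_Rintegral => w _.
  rewrite (bigA_distr_bigA (fun j i => v i * \1_(C i) (X j w))).
  by apply: eq_bigr => phi _; rewrite big_split BE.
rewrite (mean_functional_sum _ _ QP); last first.
  by move=> phi; exact: bounded_measurable_indic.
rewrite (mean_functional_sum _ _ Qmu); last first.
  by move=> i; exact: bounded_measurable_indic.
rewrite -[in RHS](card_ord m) -prodr_const.
rewrite (bigA_distr_bigA (fun _ i => v i * \int[mu]_x \1_(C i) x)).
apply: eq_bigr => phi _; rewrite Rintegral_indic// PB big_split/=.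
by congr (_ * _); apply: eq_bigr => j _; rewrite Rintegral_indic.
Qed.

(** The Chernoff bound asks for this direction only, so approximation from above by simple functions
    suffices; the error 1/(n+1) then tends to 0. *)
Lemma iid_product_le (f : R -> R) :
  bounded_measurable f -> (forall x, 0 <= f x) ->
  (\int[P]_w \prod_j f (X j w))%R <= (\int[mu]_x f x) ^+ m.
Proof.
move=> bf f0.
have [QPD QPZ QPle] := QP; have [QmD QmZ Qmle] := Qmu.
have step n : (\int[P]_w \prod_j f (X j w))%R <=
    ((\int[mu]_x f x) + n.+1%:R^-1) ^+ m.
  pose e : R := n.+1%:R^-1.
  have e0 : 0 < e by rewrite invr_gt0.
  have [k [v [C [mC fG Gf]]]] := simple_upper_approx e0 bf f0.
  pose G x := \sum_i v i * \1_(C i) x.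
  have bG : bounded_measurable G.
    apply: bounded_measurable_sum => i; apply: bounded_measurableZ.
    exact: bounded_measurable_indic.
  have G0 x : 0 <= G x by rewrite (le_trans _ (fG x)).
  have bce : bounded_measurable (fun _ : R => e).
    exact: bounded_measurable_cst.
  have mu_e : (\int[mu]_x e)%R = e :> R.
    by rewrite -[e]mulr1 QmZ ?Rintegral1//; exact: bounded_measurable_cst.
  apply: (@le_trans _ _ (\int[P]_w \prod_j G (X j w))).
    apply: QPle => [||w].
    - by apply: bounded_measurable_prod => j; exact: bX.
    - by apply: bounded_measurable_prod => j; exact: bX.
    - by apply: ler_prod => j _; rewrite f0 fG.
  rewrite (iid_simple_product _ mC) -/e -mu_e -QmD//.
  have G1 : (\int[mu]_x G x)%R <= (\int[mu]_x (f x + e))%R.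
    by apply: Qmle => //; exact: bounded_measurableD.
  have G2 : 0 <= (\int[mu]_x G x)%R by exact: Rintegral_ge0.
  by rewrite lerXn2r ?nnegrE//; exact: le_trans G1.
pose b := (\int[mu]_x f x)%R.
have cv : (fun n => (b + n.+1%:R^-1) ^+ m) @ \oo --> b ^+ m.
  have h : (fun n => b + n.+1%:R^-1) @ \oo --> b.
    rewrite -[X in _ --> X]addr0; apply: cvgD; first exact: cvg_cst.
    exact: cvg_harmonic.
  by apply: (cvg_comp (fun n => b + n.+1%:R^-1) (fun x => x ^+ m) h); exact: exprn_continuous.
rewrite -(cvg_lim _ cv)//; apply: limr_ge; first by apply/cvg_ex; exists (b ^+ m).
by near=> n; exact: step.
Unshelve. all: by end_near.
Qed.

Let measurable_le_set (S : T -> R) c : bounded_measurable S ->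
  measurable [set w | c <= S w].
Proof.
move=> [mS _]; rewrite -[X in measurable X]setTI.
have := @measurable_fun_ler _ _ _ setT (cst c) S (measurable_cst _) mS.
by move=> /(_ measurableT [set true] I).
Qed.

Lemma chernoff (F : R -> R) y : bounded_measurable F ->
  fine (P [set w | m%:R * y <= \sum_j F (X j w)]) <=
  expR (- (m%:R * y)) * (\int[mu]_x expR (F x)) ^+ m.
Proof.
move=> bF; have [_ QPZ QPle] := QP.
have bS : bounded_measurable (fun w => \sum_j F (X j w)).
  by apply: bounded_measurable_sum => j; exact: bX.
have beF : bounded_measurable (fun x => expR (F x)) by exact: bounded_measurable_expR.
have bp : bounded_measurable (fun w => \prod_j expR (F (X j w))).
  by apply: bounded_measurable_prod => j; exact: (bX j beF).
rewrite -Rintegral_indic; last exact: measurable_le_set.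
apply: (@le_trans _ _ (\int[P]_w (expR (- (m%:R * y)) * \prod_j expR (F (X j w))))).
  apply: QPle => [||w].
  - by apply: bounded_measurable_indic; exact: measurable_le_set.
  - exact: bounded_measurableZ.
  - rewrite indicE -expR_sum -expRD; have [|_] := boolP (_ \in _).
      rewrite inE/= => h; rewrite -[leLHS](@expR0 R) ler_expR; lra.
    exact: expR_ge0.
rewrite QPZ// ler_wpM2l ?expR_ge0//; exact: iid_product_le.
Qed.

Hypothesis m_gt0 : (0 < m)%N.
Definition sample_mean (F : R -> R) w := (\sum_j F (X j w)) / m%:R.

Let m_gt0' : 0 < m%:R :> R. Proof. by rewrite ltr0n. Qed.

Lemma measurable_sample_mean_le (F : R -> R) c :
  bounded_measurable F -> measurable [set w | sample_mean F w <= c].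
Proof.
move=> bF; have -> : [set w | sample_mean F w <= c] =
    [set w | - (m%:R * c) <= \sum_j - F (X j w)].
  apply/seteqP; split=> w /=; rewrite sumrN lerN2 /sample_mean ler_pdivrMr//;
  by rewrite mulrC.
apply: measurable_le_set; apply: bounded_measurable_sum => j.
by under eq_fun do rewrite -mulN1r; apply: bounded_measurableZ; exact: bX.
Qed.

Lemma measurable_sample_mean_ge (F : R -> R) c :
  bounded_measurable F -> measurable [set w | c <= sample_mean F w].
Proof.
move=> bF; have -> : [set w | c <= sample_mean F w] =
    [set w | m%:R * c <= \sum_j F (X j w)].
  apply/seteqP; split=> w /=; rewrite /sample_mean ler_pdivlMr//;
  by rewrite mulrC.
apply: measurable_le_set; apply: bounded_measurable_sum => j; exact: bX.
Qed.

(** Exponential tilt with parameter 1: on [0, 1], e^-F <= 1 - F/2, because 1/e <= 1/2. The halved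
    mean cancels exactly, which leaves an exponent linear in [x]. *)
Lemma iid_lower_tail (F : R -> R) x :
  bounded_measurable F -> (forall y, 0 <= F y <= 1) ->
  fine (P [set w | sample_mean F w <= (\int[mu]_y F y) / 2 - x]) <=
  expR (- (m%:R * x)).
Proof.
move=> bF F01; have [QmD QmZ Qmle] := Qmu.
set M := (\int[mu]_y F y)%R.
have bNF : bounded_measurable (fun y => - F y).
  by under eq_fun do rewrite -mulN1r; exact: bounded_measurableZ.
have -> : [set w | sample_mean F w <= M / 2 - x] =
    [set w | m%:R * (x - M / 2) <= \sum_j - F (X j w)].
  apply/seteqP; split=> w /=; rewrite sumrN /sample_mean ler_pdivrMr// => h; lra.
apply: le_trans (chernoff _ bNF) _.
have eN y : expR (- F y) <= 1 + (- 2^-1) * F y.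
  have := expR_chord (- 1) (F01 y); rewrite mulrN1 => /le_trans; apply.
  have /andP[F0 _] := F01 y.
  have : expR (- 1) <= 1 / 2 :> R.
    have := expR_ge1Dx (1 : R); rewrite expRN => h.
    by rewrite div1r lef_pV2 ?posrE ?expR_gt0//; lra.
  by move: (expR (- 1)) => e h; nra.
have h : (\int[mu]_y expR (- F y))%R <= expR (- (M / 2)).
  apply: (@le_trans _ _ (\int[mu]_y (1 + (- 2^-1) * F y))).
    apply: Qmle => [||y]; last exact: eN.
    - exact: bounded_measurable_expR.
    - by apply: bounded_measurableD; [exact: bounded_measurable_cst|exact: bounded_measurableZ].
  rewrite QmD; [|exact: bounded_measurable_cst|exact: bounded_measurableZ].
  rewrite Rintegral1 QmZ// -/M.
  by have := expR_ge1Dx (- (M / 2)); rewrite mulNr [2^-1 * _]mulrC.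
have h0 : 0 <= (\int[mu]_y expR (- F y))%R.
  by apply: Rintegral_ge0 => y _; exact: expR_ge0.
apply: (@le_trans _ _ (expR (- (m%:R * (x - M / 2))) * expR (- (M / 2)) ^+ m)).
  by rewrite ler_wpM2l ?expR_ge0// lerXn2r ?nnegrE ?expR_ge0.
by rewrite -expRM_natl -expRD ler_expR; lra.
Qed.

(** The same with tilt 1/2, from e^(F/2) <= 1 + F on [0, 1]. *)
Lemma iid_upper_tail (F : R -> R) x :
  bounded_measurable F -> (forall y, 0 <= F y <= 1) ->
  fine (P [set w | 2 * (\int[mu]_y F y) + 2 * x <= sample_mean F w]) <=
  expR (- (m%:R * x)).
Proof.
move=> bF F01; have [QmD QmZ Qmle] := Qmu.
set M := (\int[mu]_y F y)%R.
have bhF : bounded_measurable (fun y => 2^-1 * F y) by exact: bounded_measurableZ.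
have -> : [set w | 2 * M + 2 * x <= sample_mean F w] =
    [set w | m%:R * (M + x) <= \sum_j 2^-1 * F (X j w)].
  apply/seteqP; split=> w /=; rewrite -mulr_sumr /sample_mean ler_pdivlMr// => h; lra.
apply: le_trans (chernoff _ bhF) _.
have e2 : expR (2^-1) <= 2 :> R.
  by rewrite (le_trans (expR_le_quad _))// ?ger0_norm//; lra.
have eN y : expR (2^-1 * F y) <= 1 + F y.
  have := expR_chord (2^-1) (F01 y); rewrite mulrC => /le_trans; apply.
  have /andP[F0 _] := F01 y.
  by move: (expR (2^-1)) e2 => e h; nra.
have h : (\int[mu]_y expR (2^-1 * F y))%R <= expR M.
  apply: (@le_trans _ _ (\int[mu]_y (1 + F y))).
    apply: Qmle => [||y]; last exact: eN.
    - exact: bounded_measurable_expR.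
    - by apply: bounded_measurableD => //; exact: bounded_measurable_cst.
  rewrite QmD//; last exact: bounded_measurable_cst.
  by rewrite Rintegral1 -/M expR_ge1Dx.
have h0 : 0 <= (\int[mu]_y expR (2^-1 * F y))%R.
  by apply: Rintegral_ge0 => y _; exact: expR_ge0.
apply: (@le_trans _ _ (expR (- (m%:R * (M + x))) * expR M ^+ m)).
  by rewrite ler_wpM2l ?expR_ge0// lerXn2r ?nnegrE ?expR_ge0.
by rewrite -expRM_natl -expRD ler_expR; lra.
Qed.

End IID.

(** * The good event *)

Section UnionBound.
Context (R : realType) d (T : measurableType d) (P : probability T R).

Lemma finite_bigcup_measurable (I : finType) (B : I -> set T) :
  (forall i, measurable (B i)) -> measurable (\bigcup_i B i).
Proof. by move=> mB; apply: fin_bigcup_measurable => // i _. Qed.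

Lemma union_bound (I : finType) (B : I -> set T) c :
  (forall i, measurable (B i)) -> (forall i, fine (P (B i)) <= c) ->
  fine (P (\bigcup_i B i)) <= #|I|%:R * c.
Proof.
move=> mB Bc; have [_ _ Qle] := mean_functional_Rintegral P.
have bB i : bounded_measurable (\1_(B i) : T -> R) by exact: bounded_measurable_indic.
rewrite -Rintegral_indic; last exact: finite_bigcup_measurable.
apply: (@le_trans _ _ (\int[P]_w (\sum_i 1 * \1_(B i) w))).
  apply: Qle => [||w].
  - by apply: bounded_measurable_indic; exact: finite_bigcup_measurable.
  - by apply: bounded_measurable_sum => i; exact: bounded_measurableZ.
  - rewrite [leLHS]indicE; have [|_] := boolP (_ \in _).
      rewrite inE => -[i _ Bi]; rewrite (bigD1 i)//= indicE mem_set// mulr1 lerDl.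
      by apply: sumr_ge0 => j _; rewrite mul1r.
    by apply: sumr_ge0 => j _; rewrite mul1r.
rewrite (mean_functional_sum _ _ (mean_functional_Rintegral P))//.
rewrite mulr_natl -sumr_const ler_sum// => i _.
by rewrite mul1r Rintegral_indic.
Qed.

Lemma fine_probability_setU (A B : set T) : measurable A -> measurable B ->
  fine (P (A `|` B)) <= fine (P A) + fine (P B).
Proof.
move=> mA mB; rewrite -fineD ?fin_num_measure// fine_le ?fin_num_measure//.
- exact: measurableU.
- by rewrite fin_numD !fin_num_measure.
- exact: measureU2.
Qed.

End UnionBound.

Section GoodEvent.
Context (R : realType) d (T : measurableType d) (P : probability T R) (m : nat).
Variables (X : 'I_m -> {RV P >-> R}) (mu : probability R R).
Hypothesis indep : independent_RVs X.
Hypothesis law : forall j (B : set R),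
  measurable B -> P (X j @^-1` B) = mu B.
Hypothesis m_gt0 : (0 < m)%N.

Variables (D : finType) (psi : D -> R -> R) (K : R) (J : nat).
Hypotheses (K_gt0 : 0 < K) (psiK : forall i x, `|psi i x| <= K).
Hypothesis psi_meas : forall i, measurable_fun setT (psi i).
Hypothesis psi_norm : forall i, \int[mu]_x (psi i x ^+ 2) = 1.
Hypothesis J_gt0 : (0 < J)%N.
Let l := ln #|D|%:R : R.
Hypothesis D_ge4 : (4 <= #|D|)%N.
Hypothesis m_large : 4096 * 256 ^+ 2 * K ^+ 2 * 4 ^+ J * J%:R ^+ 3 * l <= m%:R.

Let Qmu := mean_functional_Rintegral mu.

Lemma mean_functional_sample_mean w : mean_functional (fun F => sample_mean X F w).
Proof.
rewrite /sample_mean; split=> [F G _ _|c F _|F G _ _ FG].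
- by rewrite big_split mulrDl.
- by rewrite -mulr_sumr mulrA.
- by rewrite ler_wpM2r// ler_sum.
Qed.

Let l_ge1 : 1 <= l.
Proof.
have D0 : 0 < #|D|%:R :> R by rewrite ltr0n (leq_trans _ D_ge4).
rewrite /l -[leLHS]expRK ler_ln ?posrE ?expR_gt0//.
apply: (@le_trans _ _ 4); last by rewrite ler_nat.
have h : expR (1 / 2) <= 2 :> R.
  by rewrite (le_trans (expR_le_quad _))// ?ger0_norm//; lra.
rewrite (_ : 1 = 2 * (1 / 2)); last by field.
by rewrite expRM_natl; have := expR_ge0 (1 / 2 : R); nra.
Qed.

Let cardD L : #|{ffun 'I_L -> D}|%:R = expR (L%:R * l).
Proof.
rewrite card_ffun card_ord natrX expRM_natl /l lnK// posrE ltr0n.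
exact: leq_trans D_ge4.
Qed.

Let j_ge1 : 1 <= J%:R :> R. Proof. by rewrite ler1n. Qed.

Let j3_ge1 : 1 <= J%:R ^+ 3 :> R. Proof. exact: exprn_ege1. Qed.

Let u_large : 4096 * 256 ^+ 2 * (4 ^+ J * (J%:R ^+ 3 * l)) <= m%:R / K ^+ 2.
Proof. rewrite ler_pdivlMr ?exprn_gt0//; apply: le_trans m_large; lra. Qed.

(** Of the exponent 3 J^3 l, the part 2 J^3 l pays for the J + 2 bad events. *)
Let fail := expR (- (3 * (J%:R ^+ 3 * l))).

Let q_ge1 : 1 <= 4 ^+ J :> R. Proof. by rewrite exprn_ege1// ler1n. Qed.

Let lz : l <= J%:R ^+ 3 * l.
Proof. by rewrite ler_peMl//; exact: le_trans l_ge1. Qed.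

Let qz : J%:R ^+ 3 * l <= 4 ^+ J * (J%:R ^+ 3 * l).
Proof. by rewrite ler_peMl// (le_trans _ lz)// (le_trans _ l_ge1). Qed.

Let bpsi i : bounded_measurable (psi i).
Proof. by split=> //; exists K. Qed.

Let bg L (phi : {ffun 'I_L -> D}) :
  bounded_measurable (fun x => draw_mean (psi^~ x) phi).
Proof.
rewrite /draw_mean; under eq_fun do rewrite mulrC.
by apply: bounded_measurableZ; exact: bounded_measurable_sum.
Qed.

Let bad_square i := [set w | 3 <= sample_mean X (fun x => psi i x ^+ 2) w].

Let bad_square_prob : fine (P (\bigcup_i bad_square i)) <= fail.
Proof.
have K2 : 0 < K ^+ 2 by rewrite exprn_gt0.
have b2 i : bounded_measurable (fun x => psi i x ^+ 2) by exact: bounded_measurableX.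
have [_ QmZ _] := Qmu.
apply: le_trans (union_bound (c := expR (- (m%:R * (2 * K ^+ 2)^-1))) _ _) _.
- by move=> i; exact: measurable_sample_mean_ge.
(* Scaled into [0, 1] the square has mean 1/K^2; twice the mean plus 2 * 1/(2K^2) is the threshold
   3/K^2. *)
- move=> i; pose F x := (K ^+ 2)^-1 * psi i x ^+ 2.
  have bF : bounded_measurable F by exact: bounded_measurableZ.
  have := iid_upper_tail indep law m_gt0 (2 * K ^+ 2)^-1 bF.
  rewrite QmZ// psi_norm mulr1 => h.
  have -> : bad_square i =
      [set w | 2 * (K ^+ 2)^-1 + 2 * (2 * K ^+ 2)^-1 <= sample_mean X F w].
    apply/seteqP; split=> w /=; rewrite /bad_square/=.
      have [_ SZ' _] := mean_functional_sample_mean w.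
      rewrite SZ'// => h3; rewrite [leRHS]mulrC ler_pdivlMr//.
      by rewrite (_ : (_ + _) * _ = 3)//; field; rewrite gt_eqF.
    have [_ SZ' _] := mean_functional_sample_mean w.
    rewrite SZ'// [X in _ <= X -> _]mulrC ler_pdivlMr//.
    by rewrite (_ : (_ + _) * _ = 3)//; field; rewrite gt_eqF.
  apply: h => y; apply/andP; split.
    by rewrite /F mulr_ge0 ?sqr_ge0// invr_ge0 ltW.
  rewrite /F ler_pdivrMl//.
  by rewrite mulr1 -real_normK ?num_real// lerXn2r ?nnegrE// ltW.
have -> : #|D|%:R = expR l :> R.
  by rewrite /l lnK// posrE ltr0n (leq_trans _ D_ge4).
rewrite -expRD ler_expR invfM mulrCA; move: u_large qz lz l_ge1.
by move: (m%:R / K ^+ 2) (4 ^+ J * _) => u v; move: (J%:R ^+ 3 * l) => z; lra.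
Qed.


(** The halves come from the form of [iid_lower_tail]; doubling the opposite inequality gives
    [level_event]. *)
Let bad_level i (phi : {ffun 'I_(level_draws J i) -> D}) :=
  [set w | sample_mean X (fun x => exceeds (K / 2 ^+ i.+1) (draw_mean (psi^~ x) phi)) w <=
    (\int[mu]_x exceeds (K / 2 ^+ i.+1) (draw_mean (psi^~ x) phi)) / 2 -
    level_slack K J i / 2].

Let bad_level_prob i : fine (P (\bigcup_phi @bad_level i phi)) <= fail.
Proof.
have K2 : 0 < K ^+ 2 by rewrite exprn_gt0.
apply: le_trans (union_bound (c := expR (- (m%:R * (level_slack K J i / 2)))) _ _) _.
- move=> phi; apply: measurable_sample_mean_le => //.
  exact: bounded_measurable_exceeds.
- move=> phi; apply: (iid_lower_tail indep law m_gt0).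
    exact: bounded_measurable_exceeds.
  by move=> y; rewrite /exceeds; case: (_ <= `|_|); rewrite ?lexx ?ler01.
rewrite cardD -expRD ler_expR /level_draws /level_slack !natrM natrX.
have n0 : 0 <= 4 ^+ i.+1 :> R by rewrite exprn_ge0.
have q0 : 0 < 4 ^+ J :> R by rewrite exprn_gt0.
have J0 : 0 < J%:R :> R by rewrite ltr0n.
set n := 4 ^+ i.+1 in n0 *.
have -> : m%:R * ((n / J%:R + 1) / (256 * K ^+ 2 * 4 ^+ J) / 2) =
    (m%:R / K ^+ 2 / 4 ^+ J) * ((n / J%:R + 1) / 512).
  by field; rewrite !gt_eqF.
have u1 : 4096 * 256 ^+ 2 * (J%:R ^+ 3 * l) <= m%:R / K ^+ 2 / 4 ^+ J.
  by rewrite ler_pdivlMr//; move: u_large; lra.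
have n1 : 0 <= (n / J%:R + 1) / 512.
  by rewrite divr_ge0 ?ler0n// addr_ge0// divr_ge0 ?(ltW J0).
have := ler_wpM2r n1 u1.
have -> : 4096 * 256 ^+ 2 * (J%:R ^+ 3 * l) * ((n / J%:R + 1) / 512) =
    8 * 256 ^+ 2 * (n * J%:R * (J%:R * l) + J%:R ^+ 3 * l).
  by field; rewrite gt_eqF.
have nj : n * J%:R * l <= n * J%:R * (J%:R * l).
  have nJ : 0 <= n * J%:R by rewrite mulr_ge0 ?(ltW J0).
  by apply: ler_wpM2l => //; rewrite ler_peMl// (le_trans _ l_ge1).
have nj0 : 0 <= n * J%:R * l.
  by rewrite !mulr_ge0 ?(ltW J0)// (le_trans _ l_ge1).
have z0 : 0 <= J%:R ^+ 3 * l by rewrite (le_trans _ lz)// (le_trans _ l_ge1).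
move: (_ * ((n / _ + _) / _)) => u h.
rewrite -(mulrA 416 n) -(mulrA 416); move: h nj nj0 z0.
move: (n * J%:R * l) (n * J%:R * (J%:R * l)) (J%:R ^+ 3 * l) => x y z; lra.
Qed.

Let bad_low (phi : {ffun 'I_(low_draws J) -> D}) :=
  [set w | sample_mean X (fun x => Num.min (draw_mean (psi^~ x) phi ^+ 2)
              ((2 * (K / 2 ^+ J)) ^+ 2)) w <=
    (\int[mu]_x Num.min (draw_mean (psi^~ x) phi ^+ 2) ((2 * (K / 2 ^+ J)) ^+ 2)) / 2
    - low_slack R J / 2].

Let bad_low_prob : fine (P (\bigcup_phi bad_low phi)) <= fail.
Proof.
have K2 : 0 < K ^+ 2 by rewrite exprn_gt0.
have q0 : 0 < 4 ^+ J :> R by rewrite exprn_gt0.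
(* Truncation makes the values at most [b] instead of K^2; scaling by [b] therefore gains the factor
   4^J that the small slack had lost. *)
pose b : R := 4 * K ^+ 2 / 4 ^+ J.
have b0 : 0 < b by rewrite divr_gt0// mulr_gt0.
have bE : (2 * (K / 2 ^+ J)) ^+ 2 = b.
  by rewrite /b expr4E; field; rewrite gt_eqF// exprn_gt0.
have [_ QmZ _] := Qmu.
pose G (phi : {ffun 'I_(low_draws J) -> D}) x :=
  Num.min (draw_mean (psi^~ x) phi ^+ 2) b.
have bG phi : bounded_measurable (G phi).
  by apply: bounded_measurable_min; exact: bounded_measurableX.
have bad_lowE phi : bad_low phi =
    [set w | sample_mean X (fun x => b^-1 * G phi x) w <=
       (\int[mu]_x (b^-1 * G phi x)) / 2 - (2048 * K ^+ 2)^-1].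
  rewrite /bad_low bE QmZ; last exact: bG.
  have SZ w : sample_mean X (fun x => b^-1 * G phi x) w =
      b^-1 * sample_mean X (G phi) w by rewrite /sample_mean -mulr_sumr mulrA.
  apply/seteqP; split=> w /=; rewrite SZ.
  - rewrite -(ler_pM2l (x := b^-1)) ?invr_gt0// => /le_trans; apply.
    rewrite mulrBr (mulrA b^-1 _ 2^-1) lerB// le_eqVlt; apply/orP; left; apply/eqP.
    by rewrite /low_slack /b; field; rewrite !gt_eqF.
  - move=> h; rewrite -(ler_pM2l (x := b^-1)) ?invr_gt0//; apply: (le_trans h).
    rewrite mulrBr (mulrA b^-1 _ 2^-1) lerB// le_eqVlt; apply/orP; left; apply/eqP.
    by rewrite /low_slack /b; field; rewrite !gt_eqF.
apply: (@le_trans _ _ (#|{ffun 'I_(low_draws J) -> D}|%:R *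
    expR (- (m%:R * (2048 * K ^+ 2)^-1)))).
  apply: union_bound => phi; rewrite bad_lowE.
    by apply: measurable_sample_mean_le => //; exact: bounded_measurableZ.
  apply: (iid_lower_tail indep law m_gt0); first exact: bounded_measurableZ.
  move=> y; apply/andP; split.
    by rewrite mulr_ge0 ?invr_ge0 ?(ltW b0)// le_min sqr_ge0 ltW.
  by rewrite ler_pdivrMl// mulr1 ge_min lexx orbT.
(* The constant of [m_large] is fitted to this case: 256^2 comes from the number of draws, 4096 is
   twice the 2048 of the exponent, and the second half absorbs [fail]. *)
rewrite cardD -expRD ler_expR /low_draws natrX natrM natrX invfM mulrCA.
have e4 : (256 * 2 ^+ J) ^+ 2 = 256 ^+ 2 * 4 ^+ J :> R by rewrite exprMn expr4E.
rewrite e4; move: u_large qz lz l_ge1.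
have ql : 4 ^+ J * l <= 4 ^+ J * (J%:R ^+ 3 * l) by rewrite ler_pM2l.
rewrite -(mulrA (256 ^+ 2)); move: ql.
move: (m%:R / K ^+ 2) (4 ^+ J * _) (4 ^+ J * _) => u v v'.
by move: (J%:R ^+ 3 * l) => z; lra.
Qed.

Lemma good_event : exists E : set T, [/\ measurable E,
  1 - expR (- (J%:R ^+ 3 * l)) <= fine (P E) &
  forall w, E w ->
  [/\ forall i, sample_mean X (fun x => psi i x ^+ 2) w <= 3,
     forall i : 'I_J, level_event psi K J (fun F => \int[mu]_x F x)
       (fun F => sample_mean X F w) i &
     low_event psi K J (fun F => \int[mu]_x F x) (fun F => sample_mean X F w)]].
Proof.
pose U1 := \bigcup_i bad_square i.
pose U2 := \bigcup_(i : 'I_J) \bigcup_phi @bad_level i phi.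
pose U3 := \bigcup_phi bad_low phi.
have mU1 : measurable U1.
  apply: finite_bigcup_measurable => i; apply: measurable_sample_mean_ge => //.
  exact: bounded_measurableX.
have mL i : measurable (\bigcup_phi @bad_level i phi).
  apply: finite_bigcup_measurable => phi; apply: measurable_sample_mean_le => //.
  exact: bounded_measurable_exceeds.
have mU2 : measurable U2 by apply: finite_bigcup_measurable => i; exact: mL.
have mU3 : measurable U3.
  apply: finite_bigcup_measurable => phi; apply: measurable_sample_mean_le => //.
  by apply: bounded_measurable_min; exact: bounded_measurableX.
have mU : measurable (U1 `|` U2 `|` U3) by apply: measurableU => //; exact: measurableU.
exists (~` (U1 `|` U2 `|` U3)); split; first exact: measurableC.
  rewrite probability_setC// fineB ?fin_num_measure//= lerD2l lerN2.
  apply: le_trans (fine_probability_setU _ _ mU3) _; first exact: measurableU.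
  apply: (@le_trans _ _ (fail + J%:R * fail + fail)).
    apply: lerD => //; apply: le_trans (fine_probability_setU _ mU1 mU2) _.
    apply: lerD => //; rewrite -[J in J%:R * _]card_ord.
    by apply: union_bound => i; [exact: mL|exact: bad_level_prob].
  rewrite (_ : fail + _ + _ = (1 + (J%:R + 1)) * fail); last by ring.
  have j3 : J%:R + 1 <= 2 * (J%:R ^+ 3 * l).
    have jj : J%:R <= J%:R ^+ 3 :> R by rewrite -[leLHS]expr1 ler_weXn2l.
    have : J%:R ^+ 3 <= J%:R ^+ 3 * l by rewrite ler_peMr// (le_trans _ j3_ge1).
    by move: jj j_ge1; move: (J%:R ^+ 3 * l) (J%:R ^+ 3) => z y; lra.
  apply: (@le_trans _ _ (expR (2 * (J%:R ^+ 3 * l)) * fail)).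
    rewrite ler_wpM2r ?expR_ge0// (le_trans (expR_ge1Dx _))// ler_expR.
    exact: j3.
  by rewrite /fail -expRD ler_expR; lra.
move=> w Ew.
have [n1 n2 n3] : [/\ ~ U1 w, ~ U2 w & ~ U3 w].
  by split=> h; apply: Ew; [left; left|left; right|right].
have [QmD QmZ Qmle] := Qmu.
split.
- move=> i; rewrite leNgt; apply/negP => /ltW h; apply: n1; by exists i.
- move=> i phi; rewrite leNgt; apply/negP => h; apply: n2.
  by exists i => //; exists phi => //; rewrite /bad_level/=; lra.
- move=> phi; rewrite leNgt; apply/negP => h; apply: n3.
  by exists phi => //; rewrite /bad_low/=; lra.
Qed.

End GoodEvent.

(** * Jackson's theorem *)

Section StepPolynomial.
Variable R : realType.
Implicit Types (u v x : R) (n : nat).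

(** The recurrence is sin((2n+3)x) + sin((2n-1)x) = 2 cos(2x) sin((2n+1)x) with 2 cos(2x) = 2 - 4
    sin(x)^2. The initial -1 is sin(-x)/sin(x). *)
Fixpoint dirichlet_pair n : {poly R} * {poly R} :=
  if n is n'.+1 then
    let: (p, q) := dirichlet_pair n' in ((2%:P - 4%:P * 'X^2) * p - q, p)
  else (1, -1).

Definition dirichlet n := (dirichlet_pair n).1.

(* The two members of the pair are sin((2n+1)x)/sin x and sin((2n-1)x)/sin x
   as polynomials in sin x. *)
Lemma dirichlet_pair_sin n x :
  (dirichlet_pair n).1.[sin x] * sin x = sin ((2 * n%:R + 1) * x) /\
  (dirichlet_pair n).2.[sin x] * sin x = sin ((2 * n%:R - 1) * x).
Proof.
elim: n => [|n [ih1 ih2]].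
  have -> : (2 * 0%:R + 1) * x = x by ring.
  have -> : (2 * 0%:R - 1) * x = - x by ring.
  by rewrite /= !hornerE/= sinN mulN1r.
rewrite /=; case: (dirichlet_pair n) ih1 ih2 => p q /= ih1 ih2.
have e : (2 * n.+1%:R - 1) * x = (2 * n%:R + 1) * x by rewrite -natr1; ring.
split; last by rewrite e.
have e1 : (2 * n.+1%:R + 1) * x = (2 * n%:R + 1) * x + x *+ 2.
  by rewrite -natr1 mulr2n; ring.
have e2 : (2 * n%:R - 1) * x = (2 * n%:R + 1) * x - x *+ 2.
  by rewrite mulr2n; ring.
have -> : ((2%:P - 4%:P * 'X^2) * p - q).[sin x] =
    (2 - 4 * sin x ^+ 2) * p.[sin x] - q.[sin x] by rewrite !hornerE.
rewrite mulrBl ih2 -mulrA ih1 e1 e2 (sinD _ (x *+ 2)) sinB.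
have -> : cos (x *+ 2) = 1 - 2 * sin x ^+ 2.
  have := cos2Dsin2 x; rewrite cos_mulr2n mulr2n; lra.
ring.
Qed.

Lemma dirichlet_sin n x :
  (dirichlet n).[sin x] * sin x = sin ((2 * n%:R + 1) * x).
Proof. by have [] := dirichlet_pair_sin n x. Qed.

Lemma size_dirichlet n : (size (dirichlet n) <= (2 * n).+1)%N.
Proof.
rewrite /dirichlet.
suff : (size (dirichlet_pair n).1 <= (2 * n).+1)%N /\
       (size (dirichlet_pair n).2 <= (2 * n).+1)%N by case.
elim: n => [|n [ih1 ih2]]; first by rewrite /= size_polyN size_poly1.
rewrite /=; case: (dirichlet_pair n) ih1 ih2 => p q /= ih1 ih2.
split; last by apply: leq_trans ih1 _; rewrite mulnS; lia.
rewrite (leq_trans (size_polyD _ _))// geq_max size_polyN; apply/andP; split.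
  apply: leq_trans (size_polyMleq _ _) _.
  have : (size (2%:P - 4%:P * 'X^2 : {poly R})%R <= 3)%N.
    rewrite (leq_trans (size_polyD _ _))// geq_max size_polyN size_polyC.
    rewrite (leq_trans (size_polyMleq _ _)) ?andbT ?size_polyXn ?size_polyC//.
      by case: (_ != 0).
    by case: (_ != 0).
  by move=> sA; move: (size _) sA (size _) ih1 => sp sA sq ih1; lia.
by apply: leq_trans ih2 _; lia.
Qed.

Lemma sin_le_id x : 0 <= x -> sin x <= x.
Proof.
move=> x0; have [c _] := MVT_segment x0
  (fun y _ => is_derive_sin y) (continuous_subspaceT (@continuous_sin R)).
by rewrite sin0 !subr0 => ->; rewrite ler_piMl// cos_le1.
Qed.

(** By the mean value theorem it is enough that cos c = 1 - 2 sin(c/2)^2 >= 1/2 on [0, 1]. *)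
Lemma half_le_sin x : 0 <= x <= 1 -> x / 2 <= sin x.
Proof.
move=> /andP[x0 x1]; have [c] := MVT_segment x0
  (fun y _ => is_derive_sin y) (continuous_subspaceT (@continuous_sin R)).
rewrite in_itv/= => /andP[c0 cx]; rewrite sin0 !subr0 => ->.
rewrite mulrC ler_wpM2r//.
have p2 := pi_ge2 R.
have s0 : 0 <= sin (c / 2) by apply: sin_ge0_pi; apply/andP; split; lra.
have s1 : sin (c / 2) <= c / 2 by apply: sin_le_id; lra.
rewrite (_ : c = (c / 2) *+ 2); last by rewrite mulr2n; field.
have s2 : sin (c / 2) ^+ 2 <= 1 / 4.
  rewrite (_ : 1 / 4 = (1 / 2) ^+ 2); last by field.
  by rewrite lerXn2r ?nnegrE ?divr_ge0//; lra.
by rewrite cos_mulr2n (mulr2n (_ ^+ 2)); have := cos2Dsin2 (c / 2) => h; lra.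
Qed.

Lemma dirichlet_le n v : -1 <= v <= 1 -> ((dirichlet n).[v] * v) ^+ 2 <= 1.
Proof.
move=> v1; rewrite -(asinK v1) dirichlet_sin.
set y := _ * asin v; have := cos2Dsin2 y; have := sqr_ge0 (cos y) => h1 h2; lra.
Qed.

(** Write v = sin y with 0 < y < 1/(2n+1). Then (2n+1)y is at most 1, so its sine is at least half
    of it, while v <= y; the quotient is at least (2n+1)/2. *)
Lemma dirichlet_ge n v : 0 < v -> v < sin (2 * n%:R + 1)^-1 ->
  n%:R <= (dirichlet n).[v].
Proof.
move=> v0; set phi0 := (2 * n%:R + 1)^-1 => vphi.
have k1 : 1 <= 2 * n%:R + 1 :> R by rewrite lerDr mulr_ge0.
have k0 : 0 < 2 * n%:R + 1 :> R by exact: lt_le_trans k1.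
have phi00 : 0 < phi0 by rewrite invr_gt0.
have phi01 : phi0 <= 1 by rewrite invf_le1.
have v1 : -1 <= v <= 1.
  apply/andP; split; first lra.
  by rewrite (le_trans (ltW vphi))// sin_le1.
have pi2 := pi_ge2 R.
have a1 := asin_geNpi2 v1; have a2 := asin_lepi2 v1.
have asv : sin (asin v) = v by exact: asinK.
have alt : asin v < phi0.
  by rewrite -ltr_sin ?asv// in_itv/=; apply/andP; split; lra.
have agt : 0 < asin v.
  by rewrite -ltr_sin ?asv ?sin0// in_itv/=; apply/andP; split; lra.
set y := asin v in a1 a2 asv alt agt.
have ky : 0 <= (2 * n%:R + 1) * y <= 1.
  apply/andP; split; first by rewrite mulr_ge0 ?(ltW k0) ?(ltW agt).
  by rewrite -[leRHS](mulfV (lt0r_neq0 k0)) ler_pM2l// ltW.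
have hs := half_le_sin ky.
rewrite -dirichlet_sin asv in hs.
have sy : v <= y by rewrite -asv sin_le_id// ltW.
have h2 : (2 * n%:R + 1) / 2 * y <= (dirichlet n).[v] * y.
  apply: (@le_trans _ _ ((dirichlet n).[v] * v)); first by lra.
  have d0 : 0 <= (dirichlet n).[v].
    rewrite -(pmulr_lge0 _ v0); apply: le_trans hs; rewrite divr_ge0//; case/andP: ky => //.
  exact: ler_wpM2l.
have : (2 * n%:R + 1) / 2 <= (dirichlet n).[v] by rewrite -(ler_pM2r agt).
by move: (dirichlet n).[v] => w; lra.
Qed.

Lemma is_derive_inv_cube x : x != 0 ->
  is_derive x 1 ((GRing.inv : R -> R) ^+ 3) (- 3 * x^-1 ^+ 4).
Proof.
move=> x0.
have h : is_derive x 1 (GRing.inv : R -> R) (- x ^- 2).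
  apply: DeriveDef; first by apply: (@derivableV _ _ (@id R)).
  by rewrite (@deriveV _ _ (@id R))// derive_id /GRing.scale/= mulr1.
apply: (is_derive_eq (is_deriveX 3 h)).
by rewrite /GRing.scale/=; field.
Qed.

(** P(v) + v^-3/3 is nonincreasing on [c, u]; the condition on the product keeps 0 out of this
    interval. *)
Lemma antiderivative_inv4_le (P : {poly R}) c u : c <= u -> 0 < c * u ->
  (forall v, c < v < u -> P^`().[v] <= v^-1 ^+ 4) ->
  P.[u] - P.[c] <= (c^-1 ^+ 3 - u^-1 ^+ 3) / 3.
Proof.
move=> cu cu0 hP.
have n0 v : c <= v <= u -> v != 0.
  by move=> /andP[cv vu]; apply/eqP => v0; move: cv vu; rewrite v0 => cv vu; nra.
pose f : R -> R := horner P + (3^-1 \*: ((GRing.inv : R -> R) ^+ 3)).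
have df v : v != 0 -> is_derive v 1 f (P^`().[v] + 3^-1 *: (- 3 * v^-1 ^+ 4)).
  by move=> v0; apply: is_deriveD; apply: is_deriveZ; exact: is_derive_inv_cube.
have cf : {within `[c, u], continuous f}.
  apply: derivable_within_continuous => v; rewrite in_itv/= => vI.
  by have [] := df v (n0 v vI).
have df' v : v \in `]c, u[ -> is_derive v 1 f (P^`().[v] + 3^-1 *: (- 3 * v^-1 ^+ 4)).
  rewrite in_itv/= => /andP[cv vu]; apply: df; apply: n0.
  by rewrite (ltW cv) (ltW vu).
move: cu; rewrite le_eqVlt => /predU1P[<-|cu]; first by rewrite !subrr mul0r.
have [v] := MVT cu df' cf.
rewrite in_itv/= => vI; have := hP v vI => hv hf.
have : f u - f c <= 0.
  rewrite hf pmulr_lle0 ?subr_gt0// /GRing.scale/=; lra.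
have fE w : f w = P.[w] + 3^-1 * w^-1 ^+ 3.
  by rewrite -[w^-1 ^+ 3]/((fun y : R => y^-1 ^+ 3) w) -exprfctE.
by rewrite !fE; lra.
Qed.

Lemma exists_antiderivative (q : {poly R}) :
  exists2 P : {poly R}, P^`() = q & (size P <= (size q).+1)%N.
Proof.
exists (\poly_(i < (size q).+1) (q`_i.-1 / i%:R)); last exact: size_poly.
apply/polyP => i; rewrite coef_deriv coef_poly ltnS.
case: ltnP => iq; last by rewrite mul0rn nth_default.
by rewrite /= -[LHS]mulr_natr divfK.
Qed.

Lemma poly_ndecr (P : {poly R}) c u : (forall v, c < v < u -> 0 <= P^`().[v]) ->
  c <= u -> P.[c] <= P.[u].
Proof.
move=> hP; rewrite le_eqVlt => /predU1P[->//|cu].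
have cP : {within `[c, u], continuous (horner P)}.
  by apply: continuous_subspaceT => v; exact: continuous_horner.
have [v] := MVT cu (fun x _ => is_derive_poly P x) cP.
rewrite in_itv/= => vI hv; rewrite -subr_ge0 hv mulr_ge0 ?hP// subr_ge0 ltW//.
Qed.

Definition unit_step u : R := (0 <= u)%R%:R.

(** The kernel is at most u^-4 away from 0 and its total mass is of order n^3, so the tails are of
    order (n|u|)^-3. The square of the Dirichlet kernel would leave tails of order 1/(n|u|), which
    are not summable over a grid. *)
Lemma step_polynomial n : (0 < n)%N -> exists2 S : {poly R},
  (size S <= 8 * n + 2)%N &
  forall u, -1 <= u <= 1 ->
    `|S.[u] - unit_step u| <= 8 / (1 + n%:R * `|u|) ^+ 2.
Proof.
move=> n0.
have [P dP sP] := exists_antiderivative ((dirichlet n) ^+ 4).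
have n1 : 1 <= n%:R :> R by rewrite ler1n.
have dge v : 0 <= P^`().[v].
  by rewrite dP horner_exp (exprM _ 2 2) sqr_ge0.
have mono c u : c <= u -> P.[c] <= P.[u] by apply: poly_ndecr => v _; exact: dge.
have dle v : -1 <= v <= 1 -> v != 0 -> P^`().[v] <= v^-1 ^+ 4.
  move=> v1 v0; have := dirichlet_le n v1.
  rewrite dP horner_exp; move: (dirichlet n).[v] => w h.
  rewrite exprVn -div1r ler_pdivlMr; last by rewrite (exprM _ 2 2) exprn_even_gt0//= sqrf_eq0.
  by rewrite -exprMn (exprM _ 2 2) exprn_ile1// sqr_ge0.
pose total := P.[1] - P.[-1].
(* The kernel is at least n^4 on an interval of length at least 1/(2(2n+1)), which is at least
   1/(6n). *)
have total_ge : n%:R ^+ 3 / 6 <= total.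
  pose k : R := 2 * n%:R + 1.
  have k0 : 0 < k by rewrite /k; lra.
  have kk : 0 <= k^-1 <= 1.
    by rewrite invr_ge0 (ltW k0) invf_le1//= /k; lra.
  have s1 := half_le_sin kk.
  have s2 := sin_le1 k^-1.
  have s0 : 0 < sin k^-1 by apply: lt_le_trans s1; rewrite divr_gt0// invr_gt0.
  have h : P.[0] + n%:R ^+ 4 * sin k^-1 <= P.[sin k^-1].
    have := @poly_ndecr (P - (n%:R ^+ 4) *: 'X) 0 (sin k^-1) _ (ltW s0).
    rewrite !hornerE/= => h; have : forall v, 0 < v < sin k^-1 ->
       0 <= (P - (n%:R ^+ 4) *: 'X)^`().[v].
      move=> v /andP[v0 vs]; rewrite (_ : _.[v] = (dirichlet n).[v] ^+ 4 - n%:R ^+ 4); last first.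
        by rewrite derivB derivZ derivX dP !hornerE.
      rewrite subr_ge0 lerXn2r ?nnegrE//; last exact: dirichlet_ge.
      by rewrite (le_trans _ (dirichlet_ge v0 vs)).
    by move=> /h; lra.
  have m1 := mono _ _ s2.
  have m0 : P.[-1] <= P.[0] by apply: mono; lra.
  have : n%:R ^+ 3 / 6 <= n%:R ^+ 4 * (k^-1 / 2).
    rewrite (_ : n%:R ^+ 4 * _ = n%:R ^+ 3 * (n%:R / (2 * k))); last first.
      by field; rewrite gt_eqF.
    rewrite ler_wpM2l ?exprn_ge0// ler_pdivlMr ?mulr_gt0// /k; lra.
  have n4 : 0 <= n%:R ^+ 4 :> R by rewrite exprn_ge0.
  have := ler_wpM2l n4 s1; rewrite /total; lra.
have total0 : 0 < total.
  by apply: lt_le_trans total_ge; rewrite divr_gt0// exprn_gt0 // ltr0n.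
exists (total^-1 *: (P - P.[-1]%:P)).
  rewrite (leq_trans (size_scale_leq _ _))// (leq_trans (size_polyD _ _))//.
  rewrite size_polyN geq_max; apply/andP; split.
    rewrite (leq_trans sP)//; have := size_poly_exp_leq (dirichlet n) 4.
    have := size_dirichlet n; lia.
  by rewrite (leq_trans (size_polyC_leq1 _))// addn2.
move=> u u1; rewrite !hornerE/=.
have /andP[u11 u12] := u1.
have mu1 := mono _ _ u11; have mu2 := mono _ _ u12.
have tail : `|total^-1 * (P.[u] - P.[-1]) - unit_step u| <= 1 /\
    (u != 0 -> `|total^-1 * (P.[u] - P.[-1]) - unit_step u| <=
      2 / (n%:R * `|u|) ^+ 3).
  rewrite /unit_step; case: (leP 0 u) => u0.
    have e : total^-1 * (P.[u] - P.[-1]) - 1 = - ((P.[1] - P.[u]) / total).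
      by rewrite /total; field; rewrite gt_eqF.
    rewrite e normrN ger0_norm; last by rewrite divr_ge0 ?(ltW total0)// subr_ge0.
    split; first by rewrite ler_pdivrMr// mul1r /total; lra.
    move=> un0; have u0' : 0 < u by rewrite lt_neqAle eq_sym un0.
    have := @antiderivative_inv4_le P u 1 u12 _ _.
    rewrite mulr1 => /(_ u0') h; have {}h : P.[1] - P.[u] <= u^-1 ^+ 3 / 3.
      apply: le_trans (h _) _; last by rewrite invr1 expr1n; lra.
      move=> v /andP[uv v1]; apply: dle; last by rewrite gt_eqF// (lt_trans u0').
      by apply/andP; split; lra.
    rewrite ger0_norm//; apply: (@le_trans _ _ ((u^-1 ^+ 3 / 3) / (n%:R ^+ 3 / 6))).
      apply: ler_pM => //; rewrite ?subr_ge0 ?invr_ge0 ?(ltW total0)//.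
      by rewrite lef_pV2 ?posrE// divr_gt0// exprn_gt0// ltr0n.
    rewrite le_eqVlt; apply/orP; left; apply/eqP; field.
    by rewrite un0 pnatr_eq0 -lt0n.
  rewrite subr0 ger0_norm; last by rewrite mulr_ge0 ?invr_ge0 ?(ltW total0)// subr_ge0.
  rewrite mulrC; split; first by rewrite ler_pdivrMr// mul1r /total; lra.
  move=> un0.
  have := @antiderivative_inv4_le P (-1) u u11 _ _.
  rewrite mulN1r oppr_gt0 => /(_ u0) h.
  have {}h : P.[u] - P.[-1] <= (- u)^-1 ^+ 3 / 3.
    apply: le_trans (h _) _; last first.
      by rewrite invrN1 invrN !exprS expr0; lra.
    move=> v /andP[v1 vu]; apply: dle; last by rewrite lt_eqF// (lt_trans vu).
    by apply/andP; split; lra.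
  rewrite ltr0_norm//; apply: (@le_trans _ _ (((- u)^-1 ^+ 3 / 3) / (n%:R ^+ 3 / 6))).
    apply: ler_pM => //; rewrite ?subr_ge0 ?invr_ge0 ?(ltW total0)//.
    by rewrite lef_pV2 ?posrE// divr_gt0// exprn_gt0// ltr0n.
  rewrite le_eqVlt; apply/orP; left; apply/eqP; field.
  by rewrite un0 pnatr_eq0 -lt0n.
have [t1 t2] := tail.
set y := n%:R * `|u| in t2 *.
have y0 : 0 <= y by rewrite mulr_ge0.
have [yl|yg] := leP y 1.
  apply: le_trans t1 _; rewrite ler_pdivlMr ?exprn_gt0//; last lra.
  nra.
have un0 : u != 0.
  by apply/eqP => u0; move: yg; rewrite /y u0 normr0 mulr0 ltr10.
apply: le_trans (t2 un0) _.
rewrite ler_pdivrMr ?exprn_gt0//; last lra.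
rewrite mulrAC ler_pdivlMr ?exprn_gt0//; last lra.
rewrite (exprS y 2).
have : (1 + y) ^+ 2 <= 4 * y ^+ 2 by nra.
have : y ^+ 2 <= y * y ^+ 2 by rewrite ler_peMl ?sqr_ge0// ltW.
lra.
Qed.

End StepPolynomial.

(** * Approximation of Hoelder functions through step functions *)

Section Jackson.
Variable R : realType.
Implicit Types (a b x M alpha : R) (f : R -> R) (n N : nat).

(** An antiderivative of (1 + |v|)^-2: increments of [h] bound the terms of the sum, which then
    telescopes. *)
Let h (v : R) := v / (1 + `|v|).

Let h_step v : (1 + `|v|)^-1 ^+ 2 <= 2 * (h v - h (v - 1)).
Proof.
rewrite /h; have [v1|v1] := leP 1 v.
  rewrite !ger0_norm ?subr_ge0//; last lra.
  rewrite (_ : 1 + (v - 1) = v); last by ring.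
  have v0 : 0 < v by lra.
  rewrite (_ : v / (1 + v) - (v - 1) / v = ((1 + v) * v)^-1); last first.
    by field; rewrite !gt_eqF//; lra.
  rewrite exprVn -div1r ler_pdivrMr ?exprn_gt0//; last lra.
  rewrite (_ : 2 * _ * _ = 2 * (1 + v) / v); last by field; rewrite !gt_eqF//; lra.
  rewrite ler_pdivlMr//; lra.
have [v0|v0] := leP v 0.
  rewrite !ler0_norm//; last lra.
  rewrite (_ : v / (1 - v) - (v - 1) / (1 - (v - 1)) = ((1 - v) * (2 - v))^-1); last first.
    by field; rewrite !gt_eqF//; lra.
  rewrite exprVn -div1r ler_pdivrMr ?exprn_gt0//; last lra.
  rewrite (_ : 2 * _ * _ = 2 * (1 - v) / (2 - v)); last by field; rewrite !gt_eqF//; lra.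
  rewrite ler_pdivlMr//; lra.
rewrite (gtr0_norm v0) ltr0_norm ?subr_lt0//.
have c1 : (1 + v)^-1 ^+ 2 <= 1.
  rewrite expr_le1 ?invr_ge0 ?invf_le1//; lra.
have c2 : v / (1 + v) >= v / 2.
  by rewrite ler_pM2l// lef_pV2 ?posrE//; lra.
have c3 : (v - 1) / (1 - (v - 1)) <= (v - 1) / 2.
  by rewrite ler_nM2l ?subr_lt0// lef_pV2 ?posrE//; lra.
lra.
Qed.

Let sum_inv_sqr (z : R) n :
  \sum_(j < n) (1 + `|j.+1%:R - z|)^-1 ^+ 2 <= 2 * (h (n%:R - z) - h (- z)).
Proof.
elim: n => [|n ih]; first by rewrite big_ord0 sub0r subrr mulr0.
rewrite big_ord_recr/=; have := h_step (n.+1%:R - z).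
rewrite (_ : n.+1%:R - z - 1 = n%:R - z); last by rewrite -natr1; ring.
lra.
Qed.

Let h_le1 v : `|h v| <= 1.
Proof.
have v0 : 0 < 1 + `|v| by have := normr_ge0 v; lra.
by rewrite /h normrM normfV (gtr0_norm v0) ler_pdivrMr// mul1r lerDr.
Qed.

Let sum_inv_sqr_le4 (z : R) n : \sum_(j < n) (1 + `|j.+1%:R - z|)^-1 ^+ 2 <= 4.
Proof.
apply: le_trans (sum_inv_sqr z n) _.
have := h_le1 (n%:R - z); have := h_le1 (- z); rewrite !ler_norml.
by move=> /andP[? ?] /andP[? ?]; lra.
Qed.

Lemma lip_class_ge0 a b M alpha f : a < b -> lip_class a b M alpha f -> 0 <= M.
Proof.
move=> ab /(_ a b); rewrite !in_itv/= !lexx (ltW ab) => /(_ isT isT) fab.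
have w0 : 0 < `|a - b| `^ alpha.
  by rewrite powR_gt0// normr_gt0 subr_eq0 lt_eqF.
by rewrite -(pmulr_lge0 M w0) (le_trans _ fab).
Qed.

Lemma jackson_grid a b M alpha f n : a < b -> 0 < alpha ->
  lip_class a b M alpha f -> (0 < n)%N ->
  exists2 p : {poly R}, (size p <= 8 * n + 2)%N &
    forall x, x \in `[a, b] ->
      `|f x - p.[x]| <= 33 * M * ((b - a) / n%:R) `^ alpha.
Proof.
move=> ab al0 lf n0; have M0 := lip_class_ge0 ab lf.
have [S sS hS] := step_polynomial R n0.
pose w := b - a; have w0 : 0 < w by rewrite subr_gt0.
have nR : 0 < n%:R :> R by rewrite ltr0n.
pose t (j : nat) : R := a + j%:R * (w / n%:R).
pose B := M * (w / n%:R) `^ alpha.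
have B0 : 0 <= B by rewrite mulr_ge0 ?powR_ge0.
have tI j : (j <= n)%N -> t j \in `[a, b].
  move=> jn; rewrite in_itv/= /t lerDl mulr_ge0 ?divr_ge0 ?(ltW w0)//=.
  rewrite -lerBrDl -/w mulrCA ler_piMr ?(ltW w0)// ler_pdivrMr// mul1r ler_nat//.
have tS j : t j.+1 - t j = w / n%:R by rewrite /t -natr1; ring.
have d0 : 0 < w / n%:R by rewrite divr_gt0.
pose D (j : nat) := f (t j.+1) - f (t j).
have DB (j : 'I_n) : `|D j| <= B.
  have := lf _ _ (tI _ (ltn_ord j)) (tI _ (ltnW (ltn_ord j))).
  by rewrite tS (gtr0_norm d0).
pose p := (f a)%:P + \sum_(j < n) D j *: (S \Po (w^-1 *: ('X - (t j.+1)%:P))).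
exists p.
  rewrite (leq_trans (size_polyD _ _))// geq_max; apply/andP; split.
    by rewrite (leq_trans (size_polyC_leq1 _))// addn2.
  apply: (big_ind (fun q : {poly R} => (size q <= 8 * n + 2)%N)).
  - by rewrite size_poly0.
  - by move=> q r sq sr; rewrite (leq_trans (size_polyD _ _))// geq_max sq.
  - move=> j _; rewrite (leq_trans (size_scale_leq _ _))// size_comp_poly2//.
    by rewrite size_scale ?size_XsubC// invr_eq0 gt_eqF.
move=> x xI; move: (xI); rewrite in_itv/= => /andP[ax xb].
(* The value at [x] of the step function that has only the first [k] jumps. *)
pose A k := f a + \sum_(j < k) D j * unit_step ((x - t j.+1) / w).
have stepE (j : nat) : unit_step ((x - t j.+1) / w) = (t j.+1 <= x)%R%:R.
  by rewrite /unit_step pmulr_lge0 ?invr_gt0// subr_ge0.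
(* As long as the grid point lies at or left of [x], the partial sum equals [f] there; once it
   passes [x], the sum is frozen at the last grid value, taken within one mesh width of [x]. *)
have hA k : (k <= n)%N -> if t k <= x then A k = f (t k) else `|f x - A k| <= B.
  elim: k => [_|k ih kn].
    by rewrite /A big_ord0 addr0 /t mul0r addr0 ax.
  have := ih (ltnW kn).
  have AS : A k.+1 = A k + D k * (t k.+1 <= x)%R%:R by rewrite /A big_ord_recr/= stepE addrA.
  have tk : t k.+1 = t k + w / n%:R by have := tS k; lra.
  case: ifPn => tkx.
    move=> Ak; case: ifPn => tk1; rewrite AS.
      by rewrite tk1 mulr1 Ak /D addrC subrK.
    rewrite (negbTE tk1) mulr0 addr0 Ak.
    apply: le_trans (lf _ _ xI (tI _ (ltnW kn))) _.
    apply: ler_wpM2l => //; apply: ge0_ler_powR; rewrite ?nnegrE ?(ltW al0) ?(ltW d0)//.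
    rewrite ger0_norm ?subr_ge0//; move: tk1; rewrite -ltNge; lra.
  move=> Ak; have -> : (t k.+1 <= x) = false.
    by apply/negbTE; move: tkx; rewrite -!ltNge; lra.
  rewrite AS (_ : (t k.+1 <= x) = false) ?mulr0 ?addr0//.
  by apply/negbTE; move: tkx; rewrite -!ltNge; lra.
have fA : `|f x - A n| <= B.
  have tn : t n = b by rewrite /t /w mulrC divfK ?gt_eqF// addrC subrK.
  have := hA n (leqnn _); rewrite tn; case: ifPn => // bx ->.
  by rewrite (_ : x = b) ?subrr ?normr0//; apply/eqP; rewrite eq_le xb bx.
have pA : `|A n - p.[x]| <= 32 * B.
  have -> : A n - p.[x] = - \sum_(j < n) D j *
      (S.[(x - t j.+1) / w] - unit_step ((x - t j.+1) / w)).
    rewrite /p /A hornerD hornerC horner_sum opprD addrACA subrr add0r.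
    rewrite -sumrB -sumrN; apply: eq_bigr => j _.
    rewrite hornerZ horner_comp !hornerE [w^-1 * _]mulrC; ring.
  rewrite normrN (le_trans (ler_norm_sum _ _ _))//.
  (* The position of [x] in units of the mesh. *)
  pose z := (x - a) / (w / n%:R).
  apply: (@le_trans _ _ (\sum_(j < n) B * (8 * (1 + `|j.+1%:R - z|)^-1 ^+ 2))).
    apply: ler_sum => j _; rewrite normrM ler_pM//.
    have uI : -1 <= (x - t j.+1) / w <= 1.
      have := tI _ (ltn_ord j); rewrite in_itv/= => /andP[t1 t2].
      by rewrite ler_pdivlMr// ler_pdivrMr// /w; apply/andP; split; lra.
    apply: le_trans (hS _ uI) _; rewrite -exprVn.
    rewrite (_ : n%:R * `|_| = `|j.+1%:R - z|)//.
    rewrite -{1}(gtr0_norm nR) -normrM distrC; congr `|_|.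
    by rewrite /z /t; field; rewrite !gt_eqF.
  rewrite -!mulr_sumr; have := sum_inv_sqr_le4 z n => h4.
  rewrite mulrC ler_wpM2r//; lra.
have -> : f x - p.[x] = (f x - A n) + (A n - p.[x]) by ring.
rewrite (le_trans (ler_normD _ _))//; rewrite -mulrA -/w -/B; lra.
Qed.

Lemma powR_scale_le c y alpha : 1 <= c -> 0 <= y -> 0 < alpha <= 1 ->
  (c * y) `^ alpha <= c * y `^ alpha.
Proof.
move=> c1 y0 /andP[al0 al1]; have c0 : 0 <= c by lra.
rewrite powRM// ler_wpM2r ?powR_ge0// -[leRHS]powRr1//.
exact: ler_powR.
Qed.

Lemma jackson a b M alpha f N : a < b -> 0 < alpha <= 1 ->
  lip_class a b M alpha f -> (0 < N)%N ->
  exists2 p : {poly R}, (size p <= N.+1)%N &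
    forall x, x \in `[a, b] ->
      `|f x - p.[x]| <= 1056 * (((b - a) / 2) `^ alpha * M / N%:R `^ alpha).
Proof.
move=> ab al01 lf N0; have M0 := lip_class_ge0 ab lf.
have /andP[al0 al1] := al01.
have w0 : 0 < b - a by rewrite subr_gt0.
have N0' : 0 < N%:R :> R by rewrite ltr0n.
pose y := (b - a) / 2 / N%:R.
have y0 : 0 <= y by rewrite !divr_ge0 ?(ltW w0).
have yE : ((b - a) / 2) `^ alpha * M / N%:R `^ alpha = M * y `^ alpha.
  have -> : (b - a) / 2 = y * N%:R by rewrite /y divfK ?gt_eqF.
  rewrite powRM ?(ltW N0')//; field; rewrite gt_eqF// powR_gt0//.
rewrite yE.
have My : 0 <= M * y `^ alpha by rewrite mulr_ge0 ?powR_ge0.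
have [N9|N9] := leqP 9 N.
  (* The largest [n] whose polynomial has degree 8n + 1 <= N. Since N <= 16 n, the mesh is at most
     32 y, and 1056 = 33 * 32. *)
  pose n := ((N - 1) %/ 8)%N.
  have n0 : (0 < n)%N by rewrite /n; lia.
  have nN : (8 * n + 2 <= N.+1)%N by rewrite /n; lia.
  have Nn : (N <= 16 * n)%N by rewrite /n; lia.
  have [p sp hp] := jackson_grid ab al0 lf n0.
  exists p; first exact: leq_trans sp nN.
  move=> x xI; apply: le_trans (hp x xI) _.
  have n0' : 0 < n%:R :> R by rewrite ltr0n.
  have : ((b - a) / n%:R) `^ alpha <= 32 * y `^ alpha.
    apply: le_trans (powR_scale_le _ y0 al01); last by rewrite ler1n.
    apply: ge0_ler_powR; rewrite ?nnegrE ?(ltW al0)//.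
    - by rewrite divr_ge0 ?(ltW w0).
    - by rewrite mulr_ge0.
    - rewrite (_ : 32 * y = (b - a) * (16 / N%:R)); last by rewrite /y; field; rewrite gt_eqF.
      rewrite ler_pM2l// ler_pdivlMr// mulrC ler_pdivrMr//.
      by rewrite -natrM ler_nat.
  move=> /(ler_wpM2l M0); move: (_ `^ alpha) (y `^ alpha) => u v hu; lra.
(* For N <= 8 a constant is enough, because b - a = 2 N y is at most 16 y. *)
exists (f a)%:P; first by rewrite (leq_trans (size_polyC_leq1 _)).
move=> x xI; rewrite hornerC.
have aI : a \in `[a, b] by rewrite in_itv/= lexx ltW.
apply: le_trans (lf _ _ xI aI) _.
move: (xI); rewrite in_itv/= => /andP[ax xb].
have : `|x - a| `^ alpha <= 16 * y `^ alpha.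
  apply: le_trans (powR_scale_le _ y0 al01); last by rewrite ler1n.
  apply: ge0_ler_powR; rewrite ?nnegrE ?(ltW al0)//; first by rewrite mulr_ge0.
  rewrite ger0_norm ?subr_ge0//; apply: (@le_trans _ _ (b - a)); first by lra.
  rewrite (_ : 16 * y = (b - a) * (8 / N%:R)); last by rewrite /y; field; rewrite gt_eqF.
  by rewrite ler_pMr// ler_pdivlMr// mul1r ler_nat -ltnS.
move=> /(ler_wpM2l M0) => hu; apply: (le_trans hu).
by rewrite mulrCA ler_wpM2r// ler_nat.
Qed.

End Jackson.

(** * The sampled orthonormal system *)

Section SupNorm.
Variable R : realType.
Implicit Types (a b x : R) (g f : R -> R) (p : {poly R}).

Lemma le_sup_norm a b g B x : (forall y, y \in `[a, b] -> `|g y| <= B) ->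
  x \in `[a, b] -> `|g x| <= sup_norm a b g.
Proof.
move=> gB xI; apply: ub_le_sup; last by exists x.
by exists B => _ [y yI <-]; exact: gB.
Qed.

Lemma sup_norm_le a b g B : a <= b -> (forall x, x \in `[a, b] -> `|g x| <= B) ->
  sup_norm a b g <= B.
Proof.
move=> ab gB; apply: ge_sup; last by move=> _ [y yI <-]; exact: gB.
by exists `|g a|; exists a => //=; rewrite in_itv/= lexx.
Qed.

Lemma sup_norm_ge0 a b g : 0 <= sup_norm a b g.
Proof.
rewrite /sup_norm; set A := (X in sup X).
(* A set without supremum has [sup] equal to 0 by default. *)
have [hs|/sup_out ->//] := pselect (has_sup A).
have [[z Az] ub] := hs; apply: le_trans (ub_le_sup ub Az).
by have [y _ <-] := Az.
Qed.

Lemma poly_bounded a b p : a <= b ->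
  exists B, forall x, x \in `[a, b] -> `|p.[x]| <= B.
Proof.
move=> ab; have [|c _ hc] := @EVT_max R (fun x => `|p.[x]|) a b ab.
  apply: continuous_subspaceT => x; apply: continuous_comp.
    exact: continuous_horner.
  exact: norm_continuous.
by exists `|p.[c]| => x /hc.
Qed.

Lemma le_sup_norm_poly a b p x : x \in `[a, b] ->
  `|p.[x]| <= sup_norm a b (fun x => p.[x]).
Proof.
move=> xI; have ab : a <= b.
  by move: xI; rewrite in_itv/= => /andP[]; exact: le_trans.
by have [B hB] := poly_bounded p ab; exact: le_sup_norm hB xI.
Qed.

End SupNorm.

Section Sampling.
Context (R : realType) (a b : R) (nu : R -> R) (N m : nat) (K : R).
Hypotheses (nuP : prob_density a b nu) (m_gt0 : (0 < m)%N).
Hypotheses (N_gt0 : (0 < N)%N) (K_ge1 : 1 <= K).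
Variable psi : 'I_N.+1 -> {poly R}.
Hypothesis psi_on : orthonormal_wrt a b nu psi.
Hypothesis psiK : forall k, sup_norm a b (fun x => (psi k).[x]) <= K.
Context d (T : measurableType d) (P : probability T R) (X : 'I_m -> {RV P >-> R}).
Hypotheses (indep : independent_RVs X) (densX : forall j, has_density a b nu (X j)).

(** All samples share one law by [densX]; the law of the sample with index 0 represents it, so no
    measure has to be built from [nu]. *)
Let mu : probability R R := distribution P (X (Ordinal m_gt0)).

Let law j (B : set R) : measurable B -> P (X j @^-1` B) = mu B.
Proof.
move=> mB; have := densX (Ordinal m_gt0) mB; rewrite -(densX j mB).
by move=> /esym.
Qed.

Let I : set R := `[a, b]%classic.
Let mI : measurable I. Proof. exact: measurable_itv. Qed.

Let nu_ge0 x : I x -> 0 <= nu x.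
Proof. by move=> xI; have [_ h _] := nuP; apply: h. Qed.

Let nu_int : lebesgue_measure.-integrable I (EFin \o nu).
Proof.
have [mnu _ nu1] := nuP; apply/integrableP; split; first exact/measurable_EFinP.
apply: (@le_lt_trans _ _ 1%E); last exact: ltry.
rewrite -nu1 le_eqVlt; apply/orP; left; apply/eqP; apply: eq_integral => x.
by rewrite inE => xI /=; rewrite ger0_norm// nu_ge0.
Qed.

Let Fnu_int (F : R -> R) : bounded_measurable F ->
  lebesgue_measure.-integrable I (EFin \o (fun x => F x * nu x)).
Proof.
move=> [mF [B hB]].
have := @integrableMr _ _ _ lebesgue_measure I mI F (EFin \o nu)
  (measurable_funTS mF) _ nu_int.
apply; exists B; split; first exact: num_real.
by move=> M BM x _; apply: le_trans (hB x) _; exact: ltW.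
Qed.

Let Qnu (F : R -> R) := (\int[lebesgue_measure]_(x in I) (F x * nu x))%R.

Let mQnu : mean_functional Qnu.
Proof.
split=> [F G bF bG|c F bF|F G bF bG FG]; rewrite /Qnu.
- rewrite -RintegralD//; [|exact: Fnu_int..].
  by apply: eq_Rintegral => x _; rewrite mulrDl.
- rewrite -RintegralZl//; last exact: Fnu_int.
  by apply: eq_Rintegral => x _; rewrite mulrA.
- apply: le_Rintegral => //; [exact: Fnu_int..|].
  by move=> x xI; rewrite ler_wpM2r// nu_ge0.
Qed.

(** Links the law, used by the tail bounds, to the density, for which orthonormality is stated. *)
Let mu_eq (F : R -> R) : bounded_measurable F ->
  (forall x, 0 <= F x) -> (\int[mu]_x F x)%R = Qnu F.
Proof.
apply: (mean_functional_eq (mean_functional_Rintegral mu) mQnu) => A mA.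
rewrite Rintegral_indic// /Qnu.
transitivity (\int[lebesgue_measure]_(x in I `&` A) nu x)%R.
  by congr fine; exact: densX.
rewrite Rintegral_mkcondr; apply: eq_Rintegral => x _.
by rewrite patchE indicE; case: ifP; rewrite ?mul1r ?mul0r.
Qed.

(** The boolean is the sign. The indicator makes the bound [K] valid on the whole line; on the
    sample points it equals 1 almost surely. *)
Definition dictionary (i : 'I_N.+1 * bool) (x : R) : R :=
  (-1) ^+ i.2 * (psi i.1).[x] * \1_(I) x.

Let g k (x : R) : R := (psi k).[x] * \1_I x.

Let gK k x : `|g k x| <= K.
Proof.
rewrite /g indicE; have [|_] := boolP (x \in I); last first.
  by rewrite mulr0 normr0 (le_trans _ K_ge1).
by rewrite inE => xI; rewrite mulr1 (le_trans _ (psiK k))// le_sup_norm_poly.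
Qed.

Let mg k : measurable_fun setT (g k).
Proof.
apply: measurable_funM; last exact: measurable_indic.
exact: measurable_poly.
Qed.

Let bg k : bounded_measurable (g k). Proof. by split=> //; exists K. Qed.

Let Qnu_g j k : Qnu (fun x => g j x * g k x) = (j == k)%:R.
Proof.
rewrite /Qnu -[RHS]/(fine (j == k)%:R%:E) -psi_on; congr fine.
apply: eq_integral => x; rewrite inE => xI.
by rewrite /g indicE mem_set// !mulr1.
Qed.

Let mu_sqr (c : 'I_N.+1 -> R) :
  (\int[mu]_x (\sum_k c k * g k x) ^+ 2)%R = \sum_k c k ^+ 2.
Proof.
have bs : bounded_measurable (fun x => \sum_k c k * g k x).
  by apply: bounded_measurable_sum => k; exact: bounded_measurableZ.
rewrite mu_eq; [|exact: bounded_measurableX|by move=> x; exact: sqr_ge0].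
rewrite (_ : (fun x => _ ^+ 2) = (fun x =>
    \sum_(jk : 'I_N.+1 * 'I_N.+1) (c jk.1 * c jk.2) * (g jk.1 x * g jk.2 x))).
  rewrite mean_functional_sum//; last by move=> jk; exact: bounded_measurableM.
  under eq_bigr do rewrite Qnu_g.
  rewrite -(pair_bigA _ (fun j k => c j * c k * (j == k)%:R))/=.
  apply: eq_bigr => j _; rewrite (bigD1 j)//= eqxx mulr1 big1 ?addr0//.
  by move=> k kj; rewrite eq_sym (negbTE kj) mulr0.
apply/funext => x.
rewrite -(pair_bigA _ (fun j k => c j * c k * (g j x * g k x)))/=.
rewrite expr2 mulr_suml; apply: eq_bigr => j _.
by rewrite mulr_sumr; apply: eq_bigr => k _; ring.
Qed.

Let dictionaryE i x : dictionary i x = (-1) ^+ i.2 * g i.1 x.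
Proof. by rewrite /dictionary /g mulrA. Qed.

Let dictionaryK i x : `|dictionary i x| <= K.
Proof. by rewrite dictionaryE normrM normrX normrN1 expr1n mul1r. Qed.

Let dictionary_meas i : measurable_fun setT (dictionary i).
Proof.
have -> : dictionary i = (fun x => (-1) ^+ i.2 * g i.1 x).
  by apply/funext => x; exact: dictionaryE.
by have [] := bounded_measurableZ ((-1) ^+ i.2) (bg i.1).
Qed.

Let dictionary_norm i : (\int[mu]_x (dictionary i x ^+ 2))%R = 1.
Proof.
pose c (k : 'I_N.+1) : R := (k == i.1)%:R.
transitivity (\int[mu]_x (\sum_k c k * g k x) ^+ 2)%R.
  apply: eq_Rintegral => x _; rewrite dictionaryE exprMn -exprM mulnC exprM sqrrN.
  rewrite !expr1n mul1r (bigD1 i.1)//= /c eqxx mul1r big1 ?addr0// => k ki.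
  by rewrite (negbTE ki) mul0r.
rewrite mu_sqr (bigD1 i.1)//= /c eqxx expr1n big1 ?addr0// => k ki.
by rewrite (negbTE ki) expr0n.
Qed.

(** Positive and negative parts of the coefficients, normalized to total weight 1: they express v /
    |v|_1 as a convex combination of signed basis functions. *)
Let signed_weight (v : 'cV[R]_N.+1) (i : 'I_N.+1 * bool) : R :=
  Num.max ((-1) ^+ i.2 * v i.1 0) 0 / \sum_k `|v k 0|.

Let max_sum (r : R) : Num.max r 0 + Num.max (- r) 0 = `|r|.
Proof.
rewrite !maxEle; have [r0|r0] := leP r 0.
  by rewrite oppr_le0 ler0_norm//; case: ifP => h; [apply/eqP; rewrite eq_le; lra|rewrite add0r].
by rewrite oppr_le0 ltW// addr0 gtr0_norm.
Qed.

Let max_diff (r : R) : Num.max r 0 - Num.max (- r) 0 = r.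
Proof.
rewrite !maxEle; have [r0|r0] := leP r 0.
  by rewrite oppr_le0; case: ifP => h; [apply/eqP; rewrite eq_le; lra|rewrite sub0r opprK].
by rewrite oppr_le0 ltW// subr0.
Qed.

Let sum_bool (F : bool -> R) : \sum_(b : bool) F b = F false + F true.
Proof. by rewrite big_bool/= addrC. Qed.

Let weight_sum1 (v : 'cV[R]_N.+1) : 0 < \sum_k `|v k 0| -> \sum_i signed_weight v i = 1.
Proof.
move=> L0; rewrite -mulr_suml.
rewrite -(pair_bigA _ (fun k (b : bool) => Num.max ((-1) ^+ b * v k 0) 0))/=.
rewrite (eq_bigr (fun k => `|v k 0|)) ?divff ?gt_eqF// => k _.
by rewrite sum_bool expr0 mul1r expr1 mulN1r max_sum.
Qed.

Let weight_expand (v : 'cV[R]_N.+1) x :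
  \sum_i signed_weight v i * dictionary i x =
  \sum_k (v k 0 / \sum_k `|v k 0|) * g k x.
Proof.
rewrite -(pair_bigA _ (fun k (b : bool) =>
  signed_weight v (k, b) * dictionary (k, b) x))/=.
apply: eq_bigr => k _; rewrite sum_bool !dictionaryE /signed_weight/=.
rewrite expr0 !mul1r expr1 !mulN1r -{3}(max_diff (v k 0)); ring.
Qed.

(** For the normalized combination the second moment is |v|_2^2 / |v|_1^2 by Parseval, so the cone
    condition is precisely the lower bound 4^-J of [restricted_lower_bound]. *)
Lemma sampling_event J : (0 < J)%N ->
  4096 * 256 ^+ 2 * K ^+ 2 * 4 ^+ J * J%:R ^+ 3 * ln (N.+1 * 2)%:R <= m%:R ->
  exists E : set T, [/\ measurable E,
    1 - expR (- (J%:R ^+ 3 * ln (N.+1 * 2)%:R)) <= fine (P E) &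
    forall w, E w -> (forall j, X j w \in `[a, b]) /\
    forall v : 'cV[R]_N.+1,
      (\sum_k `|v k 0|) ^+ 2 <= 4 ^+ J * \sum_k v k 0 ^+ 2 ->
      \sum_k v k 0 ^+ 2 <= 400 *
        ((\sum_j (sampling_mx psi (fun j => X j w) *m v) j 0 ^+ 2) / m%:R)].
Proof.
move=> J0 mJ.
have cD : #|{: 'I_N.+1 * bool}| = (N.+1 * 2)%N by rewrite card_prod card_ord card_bool.
have D4 : (4 <= #|{: 'I_N.+1 * bool}|)%N by rewrite cD; move: N_gt0; case: N.
have K0 : 0 < K by exact: lt_le_trans K_ge1.
have mJ' := mJ; rewrite -cD in mJ'.
have [E [mE PE hE]] := good_event indep law m_gt0 K0 dictionaryK dictionary_meas
  dictionary_norm J0 D4 mJ'.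
rewrite cD in PE.
(* The samples lie in [a, b] only almost surely; intersecting with [Z] costs no probability. *)
pose Z := \bigcap_j (X j @^-1` I).
have mX j : measurable (X j @^-1` I).
  by have := measurable_funPT (X j) measurableT _ mI; rewrite setTI.
have mZ : measurable Z by apply: fin_bigcap_measurable => // j _.
have muI : mu I = 1%E.
  rewrite -(law (Ordinal m_gt0) mI); have [_ _ <-] := nuP.
  by have := densX (Ordinal m_gt0) mI; rewrite setIid.
have PZ : P Z = 1%E.
  rewrite indep//; apply: big1 => j _; by rewrite law// muI.
exists (E `&` Z); split; first exact: measurableI.
  apply: (le_trans PE).
  have EZ : E `<=` (E `&` Z) `|` ~` Z by move=> w Ew; have [?|?] := pselect (Z w); [left|right].
  have mU : measurable ((E `&` Z) `|` ~` Z).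
    by apply: measurableU; [exact: measurableI|exact: measurableC].
  apply: (@le_trans _ _ (fine (P ((E `&` Z) `|` ~` Z)))).
    by apply: fine_le; rewrite ?fin_num_measure//; apply: le_measure; rewrite ?inE.
  apply: le_trans (fine_probability_setU _ (measurableI _ _ mE mZ) (measurableC mZ)) _.
  by rewrite probability_setC// PZ subee// addr0.
move=> w [Ew Zw].
have XI j : I (X j w) by exact: Zw.
split=> [j|v hv]; first exact: XI.
have [h1 h2 h3] := hE w Ew.
have [L0|] := ltP 0 (\sum_k `|v k 0|); last first.
  move=> L0; have v0 k : v k 0 = 0.
    apply/eqP; rewrite -normr_le0; apply: le_trans L0.
    by rewrite (bigD1 k)//= lerDl sumr_ge0.
  rewrite big1 => [|k _]; last by rewrite v0 expr0n.
  apply: mulr_ge0; first exact: ler0n.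
  by rewrite divr_ge0 ?ler0n// sumr_ge0// => j _; exact: sqr_ge0.
set L := \sum_k `|v k 0| in L0 hv.
have p0 i : 0 <= signed_weight v i.
  by rewrite /signed_weight divr_ge0 ?(ltW L0)// le_max lexx orbT.
have Q1v i : (\int[mu]_x (dictionary i x ^+ 2))%R <= 3 by rewrite dictionary_norm ler1n.
have mQ1 := mean_functional_Rintegral mu.
have mQ2 : mean_functional (fun F : R -> R => sample_mean X F w).
  exact: mean_functional_sample_mean.
have RE := restricted_lower_bound K0 dictionaryK dictionary_meas J0 mQ1 mQ2 Q1v h1 h2 h3
  p0 (weight_sum1 L0).
have L2 : 0 < L ^+ 2 by rewrite exprn_gt0.
have q1 : (\int[mu]_x (\sum_i signed_weight v i * dictionary i x) ^+ 2)%R =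
    (\sum_k v k 0 ^+ 2) / L ^+ 2.
  transitivity (\int[mu]_x (\sum_k (v k 0 / L) * g k x) ^+ 2)%R.
    by apply: eq_Rintegral => x _; rewrite weight_expand.
  by rewrite mu_sqr mulr_suml; apply: eq_bigr => k _; rewrite expr_div_n.
have q2 : sample_mean X (fun x => (\sum_i signed_weight v i * dictionary i x) ^+ 2) w =
    ((\sum_j (sampling_mx psi (fun j => X j w) *m v) j 0 ^+ 2) / m%:R) / L ^+ 2.
  rewrite /sample_mean mulrAC; congr (_ / _); rewrite mulr_suml.
  apply: eq_bigr => j _; rewrite weight_expand -expr_div_n mxE mulr_suml; congr (_ ^+ 2).
  by apply: eq_bigr => k _; rewrite -/L mxE /g indicE mem_set// mulr1 mulrC mulrA.
rewrite q1 q2 in RE.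
have : (4 ^+ J)^-1 <= (\sum_k v k 0 ^+ 2) / L ^+ 2.
  by rewrite ler_pdivlMr// mulrC ler_pdivrMr ?exprn_gt0// mulrC.
by move=> /RE; rewrite mulrA ler_pM2r// invr_gt0.
Qed.

End Sampling.

(** * Sparse recovery *)

Section SparseRecovery.
Variable R : realType.

Lemma lp_norm1E n (z : 'cV[R]_n) : lp_norm 1 z = \sum_i `|z i 0|.
Proof.
rewrite /lp_norm invr1 powRr1; last by apply: sumr_ge0 => i _; exact: powR_ge0.
by apply: eq_bigr => i _; rewrite powRr1.
Qed.

Lemma lp_norm2E n (z : 'cV[R]_n) : lp_norm 2 z = Num.sqrt (\sum_i z i 0 ^+ 2).
Proof.
rewrite /lp_norm powR12_sqrt; last by apply: sumr_ge0 => i _; exact: powR_ge0.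
by congr Num.sqrt; apply: eq_bigr => i _; rewrite powR_mulrn// real_normK ?num_real.
Qed.

Lemma sum_sqr_ge0 n (z : 'cV[R]_n) : 0 <= \sum_i z i 0 ^+ 2.
Proof. by apply: sumr_ge0 => i _; exact: sqr_ge0. Qed.

(** The triangle inequality is used in opposite directions: |c| >= |u| - |c - u| on [T], and |c| >=
    |c - u| - |u| off [T]. *)
Lemma cone_bound n (T : {set 'I_n}) (u c : 'cV[R]_n) :
  \sum_i `|c i 0| <= \sum_i `|u i 0| ->
  \sum_i `|(c - u) i 0| <=
    2 * (\sum_(i in T) `|(c - u) i 0|) + 2 * (\sum_(i | i \notin T) `|u i 0|).
Proof.
rewrite !(bigID (mem T) predT)/= => cu.
have h1 : \sum_(i in T) `|u i 0| - \sum_(i in T) `|(c - u) i 0| <=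
    \sum_(i in T) `|c i 0|.
  rewrite -sumrB ler_sum// => i _; rewrite !mxE lerBlDr.
  by have := ler_normB (c i 0) (c i 0 - u i 0); rewrite subKr.
have h2 : \sum_(i | i \notin T) `|(c - u) i 0| - \sum_(i | i \notin T) `|u i 0| <=
    \sum_(i | i \notin T) `|c i 0|.
  rewrite -sumrB ler_sum// => i _; rewrite !mxE lerBlDr.
  exact: ler_normB.
lra.
Qed.

Lemma sqr_sum_le_card n (T : {set 'I_n}) (h : 'cV[R]_n) (s : nat) :
  (0 < s)%N -> (#|T| <= s)%N ->
  (\sum_(i in T) `|h i 0|) ^+ 2 <= s%:R * \sum_i h i 0 ^+ 2.
Proof.
move=> s0 Ts; have sR : 0 < s%:R :> R by rewrite ltr0n.
set A := \sum_(i in T) _; pose t := A / s%:R.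
have h1 : 0 <= \sum_(i in T) (`|h i 0| - t) ^+ 2 by apply: sumr_ge0 => i _; exact: sqr_ge0.
have e i : (`|h i 0| - t) ^+ 2 = h i 0 ^+ 2 + ((- 2 * t) * `|h i 0| + t ^+ 2).
  by rewrite -[h i 0 ^+ 2]real_normK ?num_real//; ring.
rewrite (eq_bigr _ (fun i _ => e i)) 2!big_split/= -mulr_sumr -/A sumr_const in h1.
have h2 : \sum_(i in T) h i 0 ^+ 2 <= \sum_i h i 0 ^+ 2.
  rewrite [leRHS](bigID (mem T))/= lerDl sumr_ge0// => i _; exact: sqr_ge0.
have h3 : t ^+ 2 *+ #|T| <= t ^+ 2 * s%:R.
  by rewrite -[leLHS]mulr_natr ler_wpM2l ?sqr_ge0// ler_nat.
have h4 : t * A = A ^+ 2 / s%:R by rewrite /t; field; rewrite gt_eqF.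
have h5 : t ^+ 2 * s%:R = A ^+ 2 / s%:R by rewrite /t; field; rewrite gt_eqF.
rewrite mulrC -ler_pdivrMr//; lra.
Qed.

(** [T] collects the entries above the threshold W s^(-1/q). Markov's inequality for the q-th powers
    bounds its size by [s]; off [T] each entry is at most its q-th power times the threshold to the
    power 1 - q. *)
Lemma stechkin n (u : 'cV[R]_n) (q : R) (s : nat) : 0 < q < 1 -> (0 < s)%N ->
  exists2 T : {set 'I_n}, (#|T| <= s)%N &
    \sum_(i | i \notin T) `|u i 0| <= lp_norm q u * s%:R `^ (1 - q^-1).
Proof.
move=> /andP[q0 q1] s0; have sR : 0 < s%:R :> R by rewrite ltr0n.
set W := lp_norm q u; have W0 : 0 <= W by exact: powR_ge0.
have S0 : 0 <= \sum_i `|u i 0| `^ q by apply: sumr_ge0 => i _; exact: powR_ge0.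
have Wq : W `^ q = \sum_i `|u i 0| `^ q.
  by rewrite /W /lp_norm -powRrM mulVf ?gt_eqF// powRr1.
pose theta := W * s%:R `^ (- q^-1).
have th0 : 0 <= theta by rewrite mulr_ge0// powR_ge0.
have thq : theta `^ q = W `^ q / s%:R.
  rewrite /theta powRM ?powR_ge0// -powRrM mulNr mulVf ?gt_eqF//.
  by rewrite powR_inv1// ltW.
pose T : {set 'I_n} := finset (fun i => theta < `|u i 0|).
exists T.
  (* If W = 0, the counting argument cannot divide by W^q, but then [u] vanishes and [T] is
     empty. *)
  have := W0; rewrite le_eqVlt => /predU1P[W00|Wp].
    rewrite (_ : T = finset.set0) ?cards0//.
    apply/finset.setP => i; rewrite finset.in_set finset.in_set0.
    apply/negbTE; rewrite -leNgt.
    have := Wq; rewrite -W00 powR0 ?gt_eqF// => /esym/eqP.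
    rewrite psumr_eq0 => [|j _]; last exact: powR_ge0.
    move=> /allP /(_ i (mem_index_enum _)) /=; rewrite powR_eq0 => /andP[/eqP -> _].
    exact: th0.
  have : #|T|%:R * theta `^ q <= W `^ q.
    rewrite Wq mulr_natl -sumr_const [leRHS](bigID (mem T))/=.
    apply: ler_wpDr; first by apply: sumr_ge0 => i _; exact: powR_ge0.
    apply: ler_sum => i; rewrite finset.in_set => hi.
    by apply: ge0_ler_powR; rewrite ?nnegrE ?(ltW q0)// ltW.
  have Wqp : 0 < W `^ q by exact: powR_gt0.
  rewrite thq mulrA ler_pdivrMr// mulrC ler_pM2l// ler_nat//.
have -> : W * s%:R `^ (1 - q^-1) = W `^ q * theta `^ (1 - q).
  rewrite /theta powRM ?powR_ge0// mulrA -powRD; last first.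
    by rewrite addrC subrK oner_eq0.
  rewrite (addrC q) subrK powRr1// -powRrM; congr (_ * _ `^ _).
  by field; rewrite gt_eqF.
rewrite Wq mulr_suml [leRHS](bigID (mem T))/=.
apply: ler_wpDl; first by apply: sumr_ge0 => i _; rewrite mulr_ge0 ?powR_ge0.
apply: ler_sum => i; rewrite finset.in_set -leNgt => hi.
rewrite -[leLHS]powRr1// -{1}(subrK q 1) addrC powRD; last by rewrite addrC subrK oner_eq0.
apply: ler_wpM2l; first exact: powR_ge0.
by apply: ge0_ler_powR; rewrite ?nnegrE ?subr_ge0 ?(ltW q1).
Qed.

(** Either the error is at most 8 times the Stechkin term, or this term is small enough to be
    absorbed, and the error lies in the cone where the restricted lower bound applies. *)
Lemma l1_recovery m n (A : 'M[R]_(m, n)) (y : 'cV[R]_m) (u c : 'cV[R]_n)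
    (q S eps : R) (s : nat) :
  0 < q < 1 -> (0 < s)%N -> (0 < m)%N -> 9 * s%:R <= S -> 0 <= eps ->
  (forall v : 'cV[R]_n, (\sum_k `|v k 0|) ^+ 2 <= S * \sum_k v k 0 ^+ 2 ->
     \sum_k v k 0 ^+ 2 <= 400 * ((\sum_j (A *m v) j 0 ^+ 2) / m%:R)) ->
  lp_norm 2 (A *m u - y) <= eps * Num.sqrt m%:R ->
  l1_solution A y (eps * Num.sqrt m%:R) c ->
  \sum_k `|(c - u) k 0| <=
    8 * (lp_norm q u * s%:R `^ (1 - q^-1)) + 120 * (eps * Num.sqrt s%:R).
Proof.
move=> q01 s0 m0 sS eps0 RE uf [cf cmin].
have mR : 0 < m%:R :> R by rewrite ltr0n.
have sR : 0 < s%:R :> R by rewrite ltr0n.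
have l1 := cmin _ uf; rewrite !lp_norm1E in l1.
have [T Ts hT] := stechkin u q01 s0.
have hc := cone_bound T l1.
set h := c - u in hc *; set sig := lp_norm q u * _ in hT *.
have h0 : 0 <= \sum_k `|h k 0| by exact: sumr_ge0.
have sig0 : 0 <= sig by rewrite mulr_ge0 ?powR_ge0.
have es0 : 0 <= eps * Num.sqrt s%:R by rewrite mulr_ge0 ?sqrtr_ge0.
have [small|large] := leP (\sum_k `|h k 0|) (8 * sig).
  by rewrite (le_trans small)// lerDl mulr_ge0 ?ler0n.
set L := \sum_k `|h k 0| in hc h0 large *.
set a := \sum_(i in T) `|h i 0| in hc *.
(* From L <= 2a + 2 sig and sig < L/8. As (8/3)^2 <= 9, this explains the factor 9 in the cone
   condition. *)
have La : L <= 8 / 3 * a.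
  clear -hc large hT; clearbody L a sig; move: (\sum_(i | i \notin T) _) hT hc => r hT hc.
  lra.
have a0 : 0 <= a by exact: sumr_ge0.
have aq := sqr_sum_le_card h s0 Ts; rewrite -/a in aq.
set Q := \sum_k h k 0 ^+ 2 in aq *.
have Q0 : 0 <= Q by exact: sum_sqr_ge0.
have L2 : L ^+ 2 <= 9 * s%:R * Q.
  apply: (@le_trans _ _ (9 * a ^+ 2)); last by rewrite -mulrA ler_pM2l.
  have : L ^+ 2 <= (8 / 3 * a) ^+ 2 by rewrite lerXn2r ?nnegrE// mulr_ge0.
  have := sqr_ge0 a; clear; clearbody L a => h1 h2; lra.
have hRE : Q <= 400 * ((\sum_j (A *m h) j 0 ^+ 2) / m%:R).
  by apply: RE; apply: (le_trans L2); rewrite ler_wpM2r.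
have sqr_le (z : 'cV[R]_m) : lp_norm 2 z <= eps * Num.sqrt m%:R ->
    \sum_j z j 0 ^+ 2 <= eps ^+ 2 * m%:R.
  rewrite lp_norm2E => hz.
  rewrite -[leLHS]sqr_sqrtr ?sum_sqr_ge0// -[m%:R in leRHS]sqr_sqrtr ?(ltW mR)//.
  by rewrite -exprMn lerXn2r ?nnegrE ?sqrtr_ge0// mulr_ge0 ?sqrtr_ge0.
have Ah : (\sum_j (A *m h) j 0 ^+ 2) / m%:R <= 4 * eps ^+ 2.
  rewrite ler_pdivrMr//.
  apply: (@le_trans _ _ (2 * (\sum_j (A *m c - y) j 0 ^+ 2) +
                        2 * (\sum_j (A *m u - y) j 0 ^+ 2))).
    rewrite !mulr_sumr -big_split ler_sum// => j _.
    have -> : (A *m h) j 0 = (A *m c - y) j 0 - (A *m u - y) j 0.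
      by rewrite /h mulmxBr !mxE; ring.
    move: ((A *m c - y) j 0) ((A *m u - y) j 0) => r1 r2.
    rewrite /= -subr_ge0 (_ : _ - _ = (r1 + r2) ^+ 2) ?sqr_ge0//; clear; ring.
  have := sqr_le _ cf; have := sqr_le _ uf; clear.
  move: (\sum_j _) (\sum_j _) => r1 r2 h1 h2; lra.
(* Two feasible points differ by at most 4 eps^2 in empirical mean square, and 9 * 400 * 4 =
   120^2. *)
have LL : L ^+ 2 <= (120 * (eps * Num.sqrt s%:R)) ^+ 2.
  apply: (le_trans L2).
  have -> : (120 * (eps * Num.sqrt s%:R)) ^+ 2 = 9 * s%:R * (1600 * eps ^+ 2).
    by rewrite !exprMn sqr_sqrtr ?(ltW sR)//; ring.
  rewrite ler_pM2l ?mulr_gt0 ?ltr0n//; apply: (le_trans hRE).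
  by move: Ah; clear; move: (_ / m%:R) (eps ^+ 2) => r1 r2 r3; lra.
have h120 : L <= 120 * (eps * Num.sqrt s%:R).
  by move: LL; rewrite ler_sqr// nnegrE mulr_ge0 ?ler0n.
by rewrite (le_trans h120)// lerDr mulr_ge0 ?ler0n.
Qed.

End SparseRecovery.

(** * Proof of the theorem *)

Section OrthonormalBasis.
Variables (R : realType) (a b : R) (nu : R -> R) (N : nat) (psi : 'I_N.+1 -> {poly R}).
Hypothesis psi_on : orthonormal_wrt a b nu psi.
Hypothesis psi_deg : degrees_increasing psi.
Hypothesis psi_le : forall k, poly_le N (psi k).

Let psi_neq0 k : psi k != 0.
Proof.
apply/eqP => pk0; have := psi_on k k; rewrite pk0 eqxx.
under eq_integral do rewrite horner0 !mul0r.
by rewrite integral0 => /eqP; rewrite eqe eq_sym oner_eq0.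
Qed.

(** Descends from the top index, where the degree is at most N; ascending from a nonzero [psi] at
    index 0 gives the reverse bound. Together they force degree k at index k. *)
Let size_psi_le j (k : 'I_N.+1) : (k + j = N)%N -> (size (psi k) <= k.+1)%N.
Proof.
elim: j k => [|j ih] k kj; first by rewrite addn0 in kj; rewrite kj; exact: psi_le.
have kN : (k.+1 < N.+1)%N by lia.
have := ih (Ordinal kN); rewrite /= addSnnS => /(_ kj) h.
have h' : (size (psi k) < size (psi (Ordinal kN)))%N by apply: psi_deg.
by rewrite -ltnS; exact: leq_trans h' h.
Qed.

Let size_psi_ge (k : 'I_N.+1) : (k < size (psi k))%N.
Proof.
case: k => k; elim: k => [|k ih] kN; first by rewrite size_poly_gt0 psi_neq0.
have kN' : (k < N.+1)%N by exact: ltnW.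
apply: leq_ltn_trans (ih kN') _; exact: psi_deg.
Qed.

Let size_psi (k : 'I_N.+1) : size (psi k) = k.+1.
Proof.
apply/eqP; rewrite eqn_leq size_psi_ge andbT.
by apply: (@size_psi_le (N - k)); have := ltn_ord k; lia.
Qed.

Let expansionD c c' : expansion psi (c + c') = expansion psi c + expansion psi c'.
Proof. by rewrite -big_split; apply: eq_bigr => k _; rewrite mxE scalerDl. Qed.

(** Since degree k occurs at index k, the leading coefficient can be removed by a multiple of one
    basis element. *)
Lemma expansion_surjective n (p : {poly R}) : (size p <= n)%N -> (n <= N.+1)%N ->
  exists c, expansion psi c = p.
Proof.
elim: n p => [|n ih] p pn nN.
  exists 0; rewrite /expansion big1 => [|k _]; last by rewrite mxE scale0r.
  by apply/esym/eqP; rewrite -size_poly_leq0.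
pose k := Ordinal nN; pose r := p`_n / (psi k)`_n.
have pk0 : (psi k)`_n != 0.
  by have := psi_neq0 k; rewrite -lead_coef_eq0 lead_coefE size_psi.
have [|c hc] := ih (p - r *: psi k) _ (ltnW nN).
  apply/leq_sizeP => j nj; rewrite coefB coefZ.
  move: nj; rewrite leq_eqVlt => /predU1P[<-|nj]; first by rewrite divfK// subrr.
  by rewrite !nth_default ?mulr0 ?subrr// ?size_psi//; exact: leq_trans pn nj.
exists (c + r *: delta_mx k 0); rewrite expansionD hc.
rewrite -[RHS](subrK (r *: psi k)); congr (_ + _).
rewrite /expansion (bigD1 k)//= !mxE !eqxx mulr1 big1 ?addr0// => j jk.
by rewrite !mxE (negbTE jk) mulr0 scale0r.
Qed.

Lemma expansion_coefs (p : {poly R}) : poly_le N p ->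
  expansion psi (coefs psi p) = p.
Proof.
move=> pN; have [c hc] := expansion_surjective pN (leqnn _).
by rewrite /coefs; apply: (xgetPex 0 (P := [set c | expansion psi c = p])); exists c.
Qed.

Lemma horner_expansion (c : 'cV[R]_N.+1) x :
  (expansion psi c).[x] = \sum_k c k 0 * (psi k).[x].
Proof. by rewrite /expansion horner_sum; under eq_bigr do rewrite hornerZ. Qed.

Lemma horner_expansionB (c c' : 'cV[R]_N.+1) x :
  (expansion psi c).[x] - (expansion psi c').[x] =
  \sum_k (c - c') k 0 * (psi k).[x].
Proof.
rewrite !horner_expansion -sumrB; apply: eq_bigr => k _.
by rewrite !mxE mulrBl.
Qed.

Lemma sampling_mx_mul m (x : 'I_m -> R) (c : 'cV[R]_N.+1) j :
  (sampling_mx psi x *m c) j 0 = (expansion psi c).[x j].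
Proof.
by rewrite horner_expansion mxE; apply: eq_bigr => k _; rewrite mxE mulrC.
Qed.

End OrthonormalBasis.

(** [J] is the least exponent with 9 s <= 4^J, and minimality gives the factor 36. The upper bound 7
    ln s uses s >= 2 to absorb the additive constant. *)
Lemma sparsity_levels (R : realType) s : (1 < s)%N -> exists J,
  [/\ (0 < J)%N, 9 * s%:R <= 4 ^+ J :> R, 4 ^+ J <= 36 * s%:R :> R &
      ln s%:R / 2 <= J%:R :> R /\ J%:R <= 7 * ln s%:R :> R].
Proof.
move=> s1; have s9 : (1 < 9 * s)%N by lia.
have /andP[l1 l2] := up_log_bounds (isT : (1 < 4)%N) s9.
set J := up_log 4 (9 * s) in l1 l2.
have sR : 2 <= s%:R :> R by rewrite ler_nat.
have sR0 : 0 < s%:R :> R by lra.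
have J0 : (0 < J)%N.
  by rewrite lt0n; apply/eqP => J0; move: l2; rewrite J0 expn0; lia.
have le1 : 9 * s%:R <= 4 ^+ J :> R by rewrite -natrX -natrM ler_nat.
have le2 : 4 ^+ J <= 36 * s%:R :> R.
  rewrite -(prednK J0) exprS.
  have : 4 ^+ J.-1 <= 9 * s%:R :> R by rewrite -natrX -natrM ler_nat ltnW.
  lra.
have e1 : 2 <= expR 1 :> R by have := expR_ge1Dx (1 : R); lra.
have e4 : expR 1 <= 4 :> R.
  have h : expR (1 / 2) <= 2 :> R.
    by rewrite (le_trans (expR_le_quad _))// ?ger0_norm//; lra.
  have -> : expR 1 = expR (1 / 2) ^+ 2 :> R by rewrite -expRM_natl; congr expR; field.
  by have := expR_ge0 (1 / 2 : R) => e0; nra.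
have ln2 : 1 / 2 <= ln (2 : R) <= 1.
  apply/andP; split.
    rewrite -[leLHS]expRK ler_ln ?posrE ?expR_gt0//.
    by rewrite (le_trans (expR_le_quad _))// ?ger0_norm//; lra.
  by rewrite -[leRHS]expRK ler_ln ?posrE ?expR_gt0.
have ln4 : ln 4 = 2 * ln 2 :> R.
  by rewrite (_ : 4 = 2 ^+ 2) ?lnXn// ?mulr_natl// -natrX.
have ln16 : ln 16 = 4 * ln 2 :> R.
  by rewrite (_ : 16 = 2 ^+ 4) ?lnXn// ?mulr_natl// -natrX.
have lns : ln 2 <= ln s%:R :> R by rewrite ler_ln ?posrE.
have lnJ n : ln (4 ^+ n) = n%:R * ln 4 :> R by rewrite lnXn// mulr_natl.
exists J; split => //; split.
  have : ln s%:R <= ln (4 ^+ J) :> R.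
    by rewrite ler_ln ?posrE ?exprn_gt0//; lra.
  rewrite lnJ ln4; have : 0 <= J%:R :> R by []; case/andP: ln2; nra.
have : ln (4 ^+ J.-1) <= ln (16 * s%:R) :> R.
  rewrite ler_ln ?posrE ?exprn_gt0 ?mulr_gt0//.
  apply: (@le_trans _ _ (9 * s%:R)); last lra.
  by rewrite -natrX -natrM ler_nat ltnW.
rewrite lnJ lnM ?posrE// ln16 ln4.
have -> : J%:R = J.-1%:R + 1 :> R by rewrite natr1 prednK.
have : 0 <= J.-1%:R :> R by [].
move: (J.-1%:R) (ln s%:R) lns ln2 => j l; move: (ln 2) => l2' lns /andP[? ?]; nra.
Qed.

Lemma lip_bounded (R : realType) (a b M alpha : R) (f : R -> R) (p : {poly R}) :
  a < b -> 0 < alpha -> lip_class a b M alpha f ->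
  exists B, forall x, x \in `[a, b] -> `|f x - p.[x]| <= B.
Proof.
move=> ab al0 lf; have M0 := lip_class_ge0 ab lf.
have [B hB] := poly_bounded p (ltW ab).
have aI : a \in `[a, b] by rewrite in_itv/= lexx ltW.
exists (M * (b - a) `^ alpha + `|f a| + B) => x xI.
rewrite (le_trans (ler_normB _ _))// lerD ?hB//.
rewrite -[f x](subrK (f a)) (le_trans (ler_normD _ _))// lerD2r.
apply: le_trans (lf _ _ xI aI) _; apply: ler_wpM2l => //.
move: xI; rewrite in_itv/= => /andP[ax xb].
apply: ge0_ler_powR; rewrite ?nnegrE ?(ltW al0) ?subr_ge0 ?(ltW ab)//.
by rewrite ger0_norm ?subr_ge0//; lra.
Qed.

(** Origin of D2: (1 + 120) * 1056 = 10648 * 12, where 120 comes from [l1_recovery], 1056 from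
    [jackson] and 12 from the prescribed C. *)
Lemma recovery_constant (R : realType) (e z g r : R) : e <= z -> z <= 1056 * g ->
  0 <= r -> 0 <= g -> e + 120 * z <= 10648 * 12 * g + r.
Proof. by move=> ez zg r0 g0; lra. Qed.

(** * The uniform error for a fixed good sample *)

Section Recovery.
Variables (R : realType) (q : R) (Theta : nat) (a b : R) (nu : R -> R) (N m s : nat) (K : R).
Hypotheses (q01 : 0 < q < 1) (Theta_gt0 : (0 < Theta)%N) (ab : a < b).
Hypotheses (N_gt0 : (0 < N)%N) (m_gt0 : (0 < m)%N) (s_gt0 : (0 < s)%N) (K_ge1 : 1 <= K).
Variable psi : 'I_N.+1 -> {poly R}.
Hypothesis psi_on : orthonormal_wrt a b nu psi.
Hypothesis psi_deg : degrees_increasing psi.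
Hypothesis psi_le : forall k, poly_le N (psi k).
Hypothesis psiK : forall k, sup_norm a b (fun x => (psi k).[x]) <= K.
Variables (f : R -> R) (M alpha : R) (popt : {poly R}).
Hypotheses (alpha01 : 0 < alpha <= 1) (lf : lip_class a b M alpha f).
Hypothesis popt_best : best_approx a b N f popt.

Let E := best_error a b N f.

Let al0 : 0 < alpha. Proof. by case/andP: alpha01. Qed.

Let fpopt x : x \in `[a, b] -> `|f x - popt.[x]| <= E.
Proof.
have [_ Eopt] := popt_best; rewrite /E -Eopt => xI.
have [B hB] := lip_bounded popt ab al0 lf.
exact: (@le_sup_norm R a b (fun x => f x - popt.[x]) B).
Qed.

Let E_ge0 : 0 <= E.
Proof. by have [_ Eopt] := popt_best; rewrite /E -Eopt sup_norm_ge0. Qed.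

Let E_le : E <= 1056 * (((b - a) / 2) `^ alpha * M / N%:R `^ alpha).
Proof.
have [p sp hp] := jackson ab alpha01 lf N_gt0.
apply: (@le_trans _ _ (sup_norm a b (fun x => f x - p.[x]))).
  apply: ge_inf; last by exists p.
  by exists 0 => _ [r _ <-]; exact: sup_norm_ge0.
exact: sup_norm_le (ltW ab) hp.
Qed.

Lemma recovery_error (x : 'I_m -> R) (S : R) (c : 'cV[R]_N.+1) :
  9 * s%:R <= S -> (forall j, x j \in `[a, b]) ->
  (forall v : 'cV[R]_N.+1, (\sum_k `|v k 0|) ^+ 2 <= S * \sum_k v k 0 ^+ 2 ->
     \sum_k v k 0 ^+ 2 <= 400 * ((\sum_j (sampling_mx psi x *m v) j 0 ^+ 2) / m%:R)) ->
  l1_solution (sampling_mx psi x) (sample_vec f x) (Theta%:R * Num.sqrt m%:R * E) c ->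
  sup_norm a b (fun y => f y - (expansion psi c).[y]) <=
    K * 8 * A_norm psi q popt * s%:R `^ (1 - q^-1)
    + (K * 10648 * Theta%:R + 1) * (12 * ((b - a) / 2) `^ alpha) * M
      * (Num.sqrt s%:R / N%:R `^ alpha).
Proof.
move=> sS xI RE csol.
have popt_le : poly_le N popt by case: popt_best.
pose u := coefs psi popt.
have uE : expansion psi u = popt := expansion_coefs psi_on psi_deg psi_le popt_le.
have ThetaR : 1 <= Theta%:R :> R by rewrite ler1n.
pose eps := Theta%:R * E.
have eps0 : 0 <= eps by rewrite mulr_ge0.
have epsE : Theta%:R * Num.sqrt m%:R * E = eps * Num.sqrt m%:R by rewrite /eps mulrAC.
rewrite epsE in csol.
(* The best approximation is feasible: its residual is at most [E] at each sample point, and Theta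
   >= 1. This is what allows minimality to be tested against [u]. *)
have uf : lp_norm 2 (sampling_mx psi x *m u - sample_vec f x) <= eps * Num.sqrt m%:R.
  apply: (@le_trans _ _ (E * Num.sqrt m%:R)); last first.
    by rewrite ler_wpM2r ?sqrtr_ge0// ler_peMl.
  rewrite lp_norm2E -[E]ger0_norm// -sqrtr_sqr -sqrtrM ?sqr_ge0//.
  apply: ler_wsqrtr; rewrite mulr_natr -[m in leRHS]card_ord -sumr_const ler_sum// => j _.
  have -> : (sampling_mx psi x *m u - sample_vec f x) j 0 = popt.[x j] - f (x j).
    by rewrite mxE sampling_mx_mul uE !mxE.
  rewrite -real_normK ?num_real// lerXn2r ?nnegrE// distrC; exact: fpopt.
have hL := l1_recovery q01 s_gt0 m_gt0 sS eps0 RE uf csol.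
have K0 : 0 <= K by exact: le_trans K_ge1.
have err : sup_norm a b (fun y => f y - (expansion psi c).[y]) <=
    E + K * \sum_k `|(c - u) k 0|.
  apply: sup_norm_le; first exact: ltW.
  move=> y yI; have -> : f y - (expansion psi c).[y] =
      (f y - popt.[y]) - ((expansion psi c).[y] - popt.[y]) by ring.
  apply: le_trans (ler_normB _ _) _; apply: lerD; first exact: fpopt.
  rewrite -uE horner_expansionB mulr_sumr (le_trans (ler_norm_sum _ _ _))//.
  apply: ler_sum => k _; rewrite normrM mulrC ler_wpM2r//.
  by apply: le_trans (le_sup_norm_poly _ yI) (psiK k).
apply: (le_trans err); rewrite -/u /A_norm -/u.
set W := lp_norm q u * _ in hL.
have sq1 : 1 <= Num.sqrt s%:R :> R.
  by rewrite -[leLHS]sqrtr1 ler_wsqrtr// ler1n.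
have -> : K * 8 * lp_norm q u * s%:R `^ (1 - q^-1) = K * (8 * W) by rewrite /W; ring.
pose G := ((b - a) / 2) `^ alpha * M / N%:R `^ alpha.
have EG : E <= 1056 * G by exact: E_le.
have G0 : 0 <= G.
  by rewrite divr_ge0 ?mulr_ge0 ?powR_ge0//; exact: lip_class_ge0 ab lf.
have -> : (K * 10648 * Theta%:R + 1) * (12 * ((b - a) / 2) `^ alpha) * M *
      (Num.sqrt s%:R / N%:R `^ alpha) =
    10648 * 12 * (K * Theta%:R * Num.sqrt s%:R * G) + 12 * Num.sqrt s%:R * G.
  by rewrite /G; ring.
have h1 := ler_wpM2l K0 hL.
apply: (@le_trans _ _ (E + K * (8 * W + 120 * (eps * Num.sqrt s%:R)))).
  by rewrite lerD2l.
pose Z := K * Theta%:R * Num.sqrt s%:R.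
have KT : 1 <= K * Theta%:R by exact: mulr_ege1.
have Z1 : 1 <= Z by exact: mulr_ege1.
have -> : E + K * (8 * W + 120 * (eps * Num.sqrt s%:R)) =
    K * (8 * W) + (E + 120 * (Z * E)) by rewrite /eps /Z; ring.
rewrite lerD2l -/Z.
have EZ : E <= Z * E by rewrite ler_peMl.
have ZEG : Z * E <= Z * (1056 * G) by rewrite ler_wpM2l// (le_trans _ Z1).
have sG : 0 <= 12 * Num.sqrt s%:R * G.
  by apply: mulr_ge0 => //; apply: mulr_ge0; rewrite ?ler0n ?sqrtr_ge0.
have ZG : Z * (1056 * G) = 1056 * (Z * G) by ring.
have ZG0 : 0 <= Z * G by rewrite mulr_ge0// (le_trans _ Z1).
rewrite ZG in ZEG; exact: recovery_constant EZ ZEG sG ZG0.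
Qed.

End Recovery.

Theorem corollary3p1 (R : realType) :
  exists C0 D1 D2 gamma : R,
    [/\ 0 < C0, 0 < D1, 0 < D2 & 0 < gamma] /\
    forall (q : R) (Theta : nat) (a b : R) (nu : R -> R)
           (N m s : nat) (K : R),
      0 < q < 1 -> (0 < Theta)%N -> a < b -> prob_density a b nu ->
      (0 < N)%N -> (0 < m)%N -> (0 < s)%N -> 1 <= K ->
      C0 * K ^+ 2 * s%:R * ln s%:R ^+ 3 * ln N.+1%:R <= m%:R ->
    forall psi : 'I_N.+1 -> {poly R},
      orthonormal_wrt a b nu psi ->
      degrees_increasing psi ->
      (forall k, poly_le N (psi k)) ->
      (forall k, sup_norm a b (fun x => (psi k).[x]) <= K) ->
    forall (d : measure_display) (T : measurableType d)
           (P : probability T R) (X : 'I_m -> {RV P >-> R}),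
      independent_RVs X ->
      (forall j, has_density a b nu (X j)) ->
    forall (f : R -> R) (M alpha : R) (popt : {poly R}),
      0 < alpha <= 1 ->
      lip_class a b M alpha f ->
      best_approx a b N f popt ->
    with_prob_ge P (1 - N.+1%:R `^ (- (gamma * ln s%:R ^+ 3)))
      [set w | forall c : 'cV[R]_N.+1,
         l1_solution (sampling_mx psi (fun j => X j w))
                     (sample_vec f (fun j => X j w))
                     (Theta%:R * Num.sqrt m%:R * best_error a b N f) c ->
         sup_norm a b (fun x => f x - (expansion psi c).[x]) <=
           K * D1 * A_norm psi q popt * s%:R `^ (1 - q^-1)
           + (K * D2 * Theta%:R + 1) * (12 * ((b - a) / 2) `^ alpha) * M
             * (Num.sqrt s%:R / N%:R `^ alpha)].
Proof.
pose B : R := 4096 * 256 ^+ 2.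
have B0 : 0 < B by rewrite mulr_gt0 ?exprn_gt0 ?ltr0n.
(* In C0, 36 turns 4^J into s, 7^3 turns J^3 into the cube of ln s, and 2 bounds ln(2(N+1)) by
   ln(N+1). The 1/8 is the cube of 1/2 in J >= ln s / 2. *)
exists (B * (36 * 7 ^+ 3 * 2)), 8, 10648, (1 / 8); split.
  by split; rewrite ?ltr0n ?divr_gt0 ?ltr0n// !mulr_gt0 ?exprn_gt0 ?ltr0n.
move=> q Theta a b nu N m s K q01 Th0 ab nuP N0 m0 s0 K1 hm psi psi_on psi_deg psi_le psiK.
move=> d T P X indep dens f M alpha popt al01 lf best.
(* For s = 1 the logarithm vanishes: the required probability is 0 and the empty event serves. *)
have [s1|s1] := leqP s 1.
  have -> : s = 1%N by apply/eqP; rewrite eqn_leq s1 s0.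
  exists set0; split => //.
  by rewrite ln1 expr0n/= mulr0 oppr0 powRr0 subrr measure0.
have [J [J0 J1 J2 [J3 J4]]] := sparsity_levels R s1.
set l := ln (N.+1%:R : R) in hm.
have l0 : 1 / 2 <= l.
  have ln2l : ln 2 <= l by rewrite ler_ln ?posrE ?ltr0n// ler_nat ltnS.
  apply: le_trans ln2l; rewrite -[leLHS]expRK ler_ln ?posrE ?expR_gt0//.
  by rewrite (le_trans (expR_le_quad _))// ?ger0_norm//; lra.
have l2 : ln (N.+1 * 2)%:R = l + ln 2 :> R by rewrite natrM lnM ?posrE ?ltr0n.
have ln2l : 0 <= ln (2 : R) <= l.
  by rewrite ln_ge0 ?ler1n//= ler_ln ?posrE ?ltr0n// ler_nat ltnS.
have ls0 : 0 <= ln s%:R :> R by rewrite ln_ge0// ler1n.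
have J0' : 0 <= J%:R :> R by [].
have l0' : 0 <= l by exact: le_trans l0.
have /andP[ln20 ln2l'] := ln2l.
have mJ : 4096 * 256 ^+ 2 * K ^+ 2 * 4 ^+ J * J%:R ^+ 3 * ln (N.+1 * 2)%:R <= m%:R :> R.
  apply: le_trans hm; rewrite l2 -/B.
  have -> : B * (36 * 7 ^+ 3 * 2) * K ^+ 2 * s%:R * ln s%:R ^+ 3 * l =
      B * K ^+ 2 * ((36 * s%:R) * (7 * ln s%:R) ^+ 3 * (2 * l)) by ring.
  have -> : B * K ^+ 2 * 4 ^+ J * J%:R ^+ 3 * (l + ln 2) =
      B * K ^+ 2 * (4 ^+ J * J%:R ^+ 3 * (l + ln 2)) by ring.
  apply: ler_wpM2l; first by rewrite mulr_ge0 ?(ltW B0)// sqr_ge0.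
  apply: ler_pM.
  - by rewrite mulr_ge0 ?exprn_ge0.
  - by rewrite addr_ge0.
  - apply: ler_pM => //; rewrite ?exprn_ge0//.
    by rewrite lerXn2r ?nnegrE// mulr_ge0.
  - by rewrite mulr_natl mulr2n lerD2l.
have [E [mE PE hE]] := sampling_event nuP m0 N0 K1 psi_on psiK indep dens J0 mJ.
exists E; split => // [|w Ew].
  rewrite -(fineK (fin_num_measure P _ mE)) lee_fin; apply: le_trans PE.
  rewrite lerD2l lerN2 l2 /powR pnatr_eq0/= ler_expR mulNr lerN2 -/l.
  apply: (@le_trans _ _ (J%:R ^+ 3 * l)); last first.
    by rewrite ler_wpM2l ?exprn_ge0// lerDl.
  rewrite ler_wpM2r//; have -> : 1 / 8 * ln s%:R ^+ 3 = (ln s%:R / 2) ^+ 3 :> R by field.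
  by rewrite lerXn2r ?nnegrE ?divr_ge0.
have [XI RE] := hE w Ew.
move=> c csol /=.
apply: (recovery_error q01 Th0 ab N0 m0 s0 K1 psi_on psi_deg psi_le psiK al01 lf best
  (S := 4 ^+ J) J1 XI RE csol).
Qed.
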